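(* Let $X$ be a finite set, $m\ge0$ an integer, and let $G\in\mathcal B(X)$ be a perturbed non-degenerate Gaussian in the variables in $X$, i.e. $$G=P\exp\Big(\frac12\sum_{x,y\in X}l_{xy}\,{}^{x}\!\frown^{y}\Big)$$ for some invertible symmetric matrix $\Lambda=(l_{xy})_{x,y\in X}$ and some $P\in\mathcal B^+(X)$. Then $$\int^{(m)}G\,dX=(-1)^{m|X|}(\det\Lambda)^m\int^{FG}G\,dX$$ in $\mathcal A^\circ_{\le m}(\emptyset)/(O_m,P_{m+1})\cong\mathcal A_{\le m}(\emptyset)$.
   Context: **Diagram spaces** (over a ground field of characteristic $0$ containing the $l_{xy}$, e.g. $\mathbb Q$ or $\mathbb R$). Trivalent vertices of all diagrams are oriented. Degree is half the number of vertices (including univalent ones). All spaces are completed with respect to degree; the subscript $\le m$ denotes the part of degree $\le m$. - $\mathcal A(\emptyset)$: spanned by (possibly disconnected or empty) trivalent graphs, modulo the standard AS and IHX relations. $\mathcal A^\circ(\emptyset)$ is the same except that diagrams may also have components that are closed circles without vertices (of degree $0$). - $\mathcal B(X)$: spanned by uni-trivalent graphs whose univalent vertices (legs) are labeled by elements of $X$, modulo AS and IHX; product (and exponential) is with respect to disjoint union. The strut ${}^{x}\!\frown^{y}$ is a single edge with no internal vertices with ends labeled $x,y$. $\mathcal B^+(X)\subset\mathcal B(X)$ is the space of strutless diagrams, in which each component has at least one internal (trivalent) vertex. **Relations.** $O_m$: disjoint union with a closed circle equals multiplication by $-2m$. $P_{m+1}$: for any diagram with $2m+2$ free stubs, the sum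 over all ways of joining these stubs in pairs is $0$. By a result of Le–Murakami–Ohtsuki, the inclusion induces an isomorphism $\mathcal A_{\le m}(\emptyset)\cong\mathcal A^\circ_{\le m}(\emptyset)/(O_m,P_{m+1})$. **Integrals.** Let $\partial_x$, $x\in X$, be dual labels. $\langle D_1,D_2\rangle_X$ denotes the sum of all ways of gluing the $\partial_x$-marked legs of $D_1$ to the $x$-marked legs of $D_2$ for all $x\in X$ ($0$ if the numbers of legs do not match). ${}_{\partial_x}\!\smile_{\partial_y}$ denotes the strut with ends labeled $\partial_x,\partial_y$. - Negative-dimensional integration: $\displaystyle\int^{(m)}G\,dX=\Big\langle\prod_{x\in X}\frac1{m!}\Big(\frac{{}_{\partial_x}\!\smile_{\partial_x}}{2}\Big)^m,\;G\Big\rangle_X\Big/(O_m,P_{m+1})\in\mathcal A^\circ(\emptyset)/(O_m,P_{m+1})$. - Formal Gaussian integration, for $G=P\exp\big(\frac12\sum l_{xy}\,{}^{x}\!\frown^{y}\big)$ as in the claim, with $(l^{xy})=\Lambda^{-1}$: $\displaystyle\int^{FG}G\,dX=\Big\langle\exp\Big(-\tfrac12\sum_{x,y\in X}l^{xy}\,{}_{\partial_x}\!\smile_{\partial_y}\Big),\;P\Big\rangle_X\in\mathcal A(\emptyset)$. *)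

(* Defs.v *)
From HB Require Import structures.
From mathcomp Require Import all_boot all_order all_algebra.
From mathcomp Require Import finmap boolp classical_sets functions cardinality fsbigop.
From mathcomp Require Import monalg.

Set Implicit Arguments.
Unset Strict Implicit.
Unset Printing Implicit Defensive.

Import GRing.Theory.
Local Open Scope ring_scope.

(** * Diagrams

    A uni-trivalent graph is encoded by naming its edges with natural numbers:
    a trivalent vertex is the triple of the edges around it, read in the cyclic
    order given by its orientation, and a leg is its label together with the
    edge ending there.  An edge has two ends, so in a well-formed diagram every
    edge name that is used is used exactly twice; a self-loop at a vertex is a
    triple [(e, e, f)] and a strut is a pair of legs [(x, e)], [(y, e)].
    Closed circles without vertices are only counted. *)
Definition vertex : Type := (nat * nat * nat)%type.

Record diagram (X : Type) := Diagram {
  verts : seq vertex;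
  legs : seq (X * nat);
  circles : nat }.

Section DiagramChoice.
Variable X : choiceType.
Definition diagram_code (D : diagram X) := (verts D, legs D, circles D).
Definition diagram_decode (c : seq vertex * seq (X * nat) * nat) : diagram X :=
  Diagram c.1.1 c.1.2 c.2.
Lemma diagram_codeK : cancel diagram_code diagram_decode.
Proof. by case. Qed.
HB.instance Definition _ :=
  Choice.copy (diagram X) (can_type diagram_codeK).
End DiagramChoice.

Definition vertex_ends (v : vertex) : seq nat := [:: v.1.1; v.1.2; v.2].

Definition ends (X : Type) (D : diagram X) : seq nat :=
  flatten (map vertex_ends (verts D)) ++ map snd (legs D).

Definition wf (X : Type) (D : diagram X) : bool :=
  all (fun e => count_mem e (ends D) == 2%N) (ends D).

Definition has_degree (X : Type) (n : nat) (D : diagram X) : bool :=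
  (size (verts D) + size (legs D) == n.*2)%N.

(* no edge of the diagram has both its ends univalent *)
Definition strutless (X : Type) (D : diagram X) : bool :=
  uniq (map snd (legs D)).

Definition ren_vertex (phi : nat -> nat) (v : vertex) : vertex :=
  (phi v.1.1, phi v.1.2, phi v.2).

Definition ren_leg (X : Type) (phi : nat -> nat) (l : X * nat) : X * nat :=
  (l.1, phi l.2).

Definition rotation (v w : vertex) : bool :=
  let: (a, b, c) := v in w \in [:: (a, b, c); (b, c, a); (c, a, b)].

(* isomorphism of oriented uni-trivalent graphs with labelled legs *)
Definition diagram_iso (X : eqType) (D D' : diagram X) : Prop :=
  exists phi : nat -> nat,
    [/\ {in ends D &, injective phi},
        exists2 vs, perm_eq vs (map (ren_vertex phi) (verts D))
                  & all2 rotation vs (verts D'),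
        perm_eq (legs D') (map (ren_leg phi) (legs D))
      & circles D' = circles D].

(* the factors' edges are made disjoint by passing to even and odd names *)
Definition evens (e : nat) : nat := e.*2.
Definition odds (e : nat) : nat := e.*2.+1.

Definition disjoint_union (X : Type) (D E : diagram X) : diagram X :=
  Diagram (map (ren_vertex evens) (verts D) ++ map (ren_vertex odds) (verts E))
          (map (ren_leg evens) (legs D) ++ map (ren_leg odds) (legs E))
          (circles D + circles E).

Definition empty_diagram (X : Type) : diagram X := Diagram [::] [::] 0.

Definition strut_diagram (X : Type) (x y : X) : diagram X :=
  Diagram [::] [:: (x, 0%N); (y, 0%N)] 0.

(** * Gluing legs *)

(* Joining the free ends of the edges [e] and [f].  The state is the current
   name of each original edge and the number of circles; joining the two ends
   of one and the same edge produces a circle. *)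
Definition join_step (s : (nat -> nat) * nat) (p : nat * nat) :
    (nat -> nat) * nat :=
  let e := s.1 p.1 in
  let f := s.1 p.2 in
  if e == f then (s.1, s.2.+1)
  else (fun g => if s.1 g == f then e else s.1 g, s.2).

(* [ps] must pair off all the legs of the diagram *)
Definition join_legs (ps : seq (nat * nat)) (vs : seq vertex) (c : nat) :
    diagram void :=
  let s := foldl join_step (id, c) ps in
  Diagram (map (ren_vertex s.1) vs) [::] s.2.

(* all ways of taking one item out of a sequence *)
Fixpoint picks (T : Type) (s : seq T) : seq (T * seq T) :=
  if s is x :: s' then (x, s') :: [seq (p.1, x :: p.2) | p <- picks s']
  else [::].

(* all label-preserving bijections from the legs [L] to the legs [M] *)
Fixpoint leg_bijections (X : eqType) (L M : seq (X * nat)) :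
    seq (seq (nat * nat)) :=
  if L is a :: L' then
    flatten [seq [seq (a.2, p.1.2) :: b | b <- leg_bijections L' p.2]
            | p <- picks M & p.1.1 == a.1]
  else if M is [::] then [:: [::]] else [::].

(* all perfect matchings of [s], whose size must be at most [n] *)
Fixpoint matchings_rec (n : nat) (s : seq nat) : seq (seq (nat * nat)) :=
  match s, n with
  | [::], _ => [:: [::]]
  | _ :: _, 0 => [::]
  | a :: s', n'.+1 =>
      flatten [seq [seq (a, p.1) :: b | b <- matchings_rec n' p.2]
              | p <- picks s']
  end.
Definition matchings (s : seq nat) := matchings_rec (size s) s.

(** * Relations

    Formal linear combinations of diagrams are the elements of
    [{malg K[diagram X]}]; a space of diagrams is the quotient by the span of
    its relators. *)
Inductive span (K : nzRingType) (V : lmodType K) (S : V -> Prop) : V -> Prop :=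
| span0 : span S 0
| span_step (c : K) (u v : V) : S u -> span S v -> span S (c *: u + v).

(* AS, IHX, and the identification of isomorphic diagrams *)
Inductive basic_relator (K : fieldType) (X : choiceType) :
    {malg K[diagram X]} -> Prop :=
| rel_iso (D D' : diagram X) :
    wf D -> wf D' -> diagram_iso D D' -> basic_relator (<< D >> - << D' >>)
| rel_AS a b c vs L k :
    wf (Diagram ((a, b, c) :: vs) L k) ->
    basic_relator (<< Diagram ((a, b, c) :: vs) L k >>
                 + << Diagram ((b, a, c) :: vs) L k >>)
| rel_IHX a b c d e vs L k :
    wf (Diagram ((a, b, e) :: (e, c, d) :: vs) L k) ->
    basic_relator (<< Diagram ((a, b, e) :: (e, c, d) :: vs) L k >>
                 + << Diagram ((b, c, e) :: (e, a, d) :: vs) L k >>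
                 + << Diagram ((c, a, e) :: (e, b, d) :: vs) L k >>).

(* a diagram with free stubs is a diagram whose legs carry the label [tt] *)
Inductive closed_relator (K : fieldType) (m : nat) :
    {malg K[diagram void]} -> Prop :=
| rel_basic f : basic_relator f -> closed_relator m f
| rel_O (D : diagram void) :
    wf D ->
    closed_relator m (<< Diagram (verts D) (legs D) (circles D).+1 >>
                      - (- (2 * m)%:R) *: << D >>)
| rel_P (D : diagram unit) :
    wf D -> size (legs D) = (2 * m + 2)%N ->
    closed_relator m
      (\sum_(ps <- matchings (map snd (legs D)))
          << join_legs ps (verts D) (circles D) >>).

(** * Completed spaces

    An element of a completed space is represented by the sequence of its
    homogeneous parts. *)
Definition series (K : fieldType) (X : choiceType) : Type :=
  nat -> {malg K[diagram X]}.

Section Series.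
Variables (K : fieldType) (X : choiceType).
Implicit Types f g : series K X.

Definition in_B f : Prop :=
  forall n D, D \in msupp (f n) -> [&& wf D, circles D == 0%N & has_degree n D].

Definition in_Bplus f : Prop :=
  in_B f /\ forall n D, D \in msupp (f n) -> strutless D.

Definition eq_B f g : Prop :=
  forall n, span (@basic_relator K X) (f n - g n).

Definition bilinear_ext (A B C : choiceType) (op : A -> B -> {malg K[C]})
    (u : {malg K[A]}) (v : {malg K[B]}) : {malg K[C]} :=
  \sum_(a <- msupp u) \sum_(b <- msupp v) (u@_a * v@_b) *: op a b.

Definition series1 : series K X :=
  fun n => if n is 0 then << empty_diagram X >> else 0.

Definition series_mul f g : series K X := fun n =>
  \sum_(i < n.+1)
    bilinear_ext (fun D E => << disjoint_union D E >>) (f i) (g (n - i)%N).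

Definition series_pow f (k : nat) : series K X := iter k (series_mul f) series1.

(* the exponential series, for [f 0 = 0]: then [f ^ k] starts in degree [k] *)
Definition series_exp f : series K X := fun n =>
  \sum_(k < n.+1) (k`!%:R)^-1 *: series_pow f k n.

Definition strut (x y : X) : series K X :=
  fun n => if n is 1 then << strut_diagram x y >> else 0.

(* The legs labelled [x] of the first argument stand for those labelled
   [\partial_x]. *)
Definition pairing_diagram (D E : diagram X) : {malg K[diagram void]} :=
  \sum_(ps <- leg_bijections (map (ren_leg evens) (legs D))
                             (map (ren_leg odds) (legs E)))
     << join_legs ps
          (map (ren_vertex evens) (verts D) ++ map (ren_vertex odds) (verts E))
          (circles D + circles E) >>.

Definition degree_part (n : nat) (u : {malg K[diagram void]}) :
    {malg K[diagram void]} :=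
  \sum_(D <- msupp u | has_degree n D) u@_D *: << D >>.

(* The sum is finitely supported in each degree in both integrals below. *)
Definition pairing f g : series K void := fun n =>
  \sum_(p \in [set: nat * nat]%classic)
     degree_part n (bilinear_ext pairing_diagram (f p.1) (g p.2)).

End Series.

Section Integrals.
Variables (K : fieldType) (X : finType).

Definition quadratic (l : X -> X -> K) : series K X :=
  2%:R^-1 *: \sum_(x : X) \sum_(y : X) l x y *: strut K x y.

Definition int_neg (m : nat) (G : series K X) : series K void :=
  pairing
    (\big[@series_mul K X/@series1 K X]_(x : X)
        ((m`!%:R)^-1 *: series_pow (2%:R^-1 *: strut K x x) m))
    G.

Definition Lambda (l : X -> X -> K) : 'M[K]_#|X| :=
  \matrix_(i, j) l (enum_val i) (enum_val j).

Definition Lambda_inv (l : X -> X -> K) (x y : X) : K :=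
  invmx (Lambda l) (enum_rank x) (enum_rank y).

(* the formal Gaussian integral of [P exp (quadratic l)] *)
Definition int_FG (l : X -> X -> K) (P : series K X) : series K void :=
  pairing (series_exp (- quadratic (Lambda_inv l))) P.

End Integrals.

(* equality in the part of degree at most [m] of the space of closed diagrams
   with circles, modulo [O_m] and [P_{m+1}] *)
Definition eq_closed (K : fieldType) (m : nat) (f g : series K void) : Prop :=
  forall n, (n <= m)%N -> span (@closed_relator K m) (f n - g n).

(* Main.v *)
Require Import Defs.
From HB Require Import structures.
From mathcomp Require Import all_boot all_order all_algebra.
From mathcomp Require Import finmap boolp classical_sets functions cardinality fsbigop.
From mathcomp Require Import perm monalg zify ring.

Set Implicit Arguments.
Unset Strict Implicit.
Unset Printing Implicit Defensive.

Import GRing.Theory.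
Local Open Scope ring_scope.

(** Negative-dimensional integration behaves like Berezin integration over
    [2m] odd variables for each label in [X]: the relation O_m says that the
    trace of the identity, a circle, is [-2m], and P_{m+1} plays the role of the
    vanishing of monomials in more than [2m] odd variables.  The theorem is then
    the evaluation of a Gaussian integral by integration by parts, followed by
    the computation of one constant.

    Everything is evaluated in the space [V] of closed diagrams modulo the
    relations.  For a diagram [D] with legs and a weight [w] on pairs of
    labels, [wick w D] is the sum over all perfect matchings of the legs of
    the product of the weights times the diagram with its legs joined
    accordingly.  It is defined by recursion, by letting the first leg choose
    its partner, but does not depend on the order of the legs when [w] is
    symmetric ([wick_perm]).  Letting every leg in turn be the first one turns
    an iterated sum over pairs of legs into a sum over matchings; this
    identifies the pairing with the exponential of a quadratic form as a [wick]
    sum ([contract_exp]).  So the formal Gaussian integral of [D] is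
    [wick (- l^{-1}) D], and the negative-dimensional integral of [D] is
    [wick delta D] when [D] has [2m |X|] legs and [0] otherwise
    ([contract_top]).

    By P_{m+1} and the pigeonhole principle, [wick delta D] vanishes as soon as
    [D] has more than [2m |X|] legs ([wick_vanish]).  Write [(x, e) D] for [D] with
    a further leg labelled [x] at the edge [e].  Apply the vanishing to [(x, e) D]
    with enough struts weighted by [l] to exceed the bound by two, and expand
    along the leg [(x, e)], which meets either a leg of [D] or one end of a strut
    ([gauss_cons]).  The result is the integration by parts
    formula [gauss_int_parts]

      sum_y l_xy I((y, e) D) = - sum over the legs (x, f) of D of I(D with e, f joined)

    for the integral [I(D)] of [D] times the Gaussian.  Multiplying by the
    inverse of [l] yields the recursion that defines [wick (- l^{-1})], so that
    [I(D)] is [wick (- l^{-1}) D] up to the value of [I] on diagrams without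
    legs ([gauss_int_wick]).

    That value is a constant times the diagram, by O_m.  The same expansion,
    applied to a diagram to which [k] struts are added, gives a recursion in
    [k] for this constant, which is Newton's recursion for the coefficients of
    [det (1 - t l) ^ m] ([gauss_closed], [newton]).  The coefficient of top
    degree is [(-1) ^ (m |X|) (det l) ^ m].

    The rest is bookkeeping: joining legs must be compatible with isomorphisms
    and with AS and IHX, and in each degree only finitely many terms of the two
    pairings survive, which are matched with one another by counting vertices
    and legs. *)

(** * Choosing items of a sequence *)

Lemma picks_map (S T : Type) (f : S -> T) (s : seq S) :
  picks (map f s) = [seq (f p.1, map f p.2) | p <- picks s].
Proof.
elim: s => [|x s IH] //=; congr cons.
by rewrite IH -!map_comp; apply: eq_map => -[].
Qed.

Lemma size_picks (T : eqType) (s : seq T) p : p \in picks s -> (size p.2).+1 = size s.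
Proof.
elim: s p => [|x s IH] p //=; rewrite inE => /orP[/eqP -> //|/mapP[q qs ->]] /=.
by rewrite IH.
Qed.

Lemma leq_size_picks (T : eqType) (s : seq T) p n :
  p \in picks s -> (size s <= n.+1)%N -> (size p.2 <= n)%N.
Proof. by move/size_picks => <-. Qed.

Lemma perm_picks (T : eqType) (s : seq T) p : p \in picks s -> perm_eq (p.1 :: p.2) s.
Proof.
elim: s p => [|x s IH] p //=; rewrite inE => /orP[/eqP -> //|/mapP[q qs ->]] /=.
have := IH _ qs; rewrite -(perm_cons x) => /(perm_trans _); apply.
by rewrite -[q.1 :: x :: _]/([:: q.1] ++ [:: x] ++ _) perm_catCA.
Qed.

Lemma map_picks1 (T : Type) (s : seq T) : map fst (picks s) = s.
Proof. by elim: s => //= x s IH; rewrite -map_comp -[in RHS]IH; congr cons; apply: eq_map. Qed.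

(** The choices of [(a, b)] and of [(b, a)] leave the same remainder, in the same
    order; so [F] need not be insensitive to the order of the remainder. *)
Lemma big_picks2C (V : nmodType) (T : Type) (s : seq T) (F : T -> T -> seq T -> V) :
  \sum_(p <- picks s) \sum_(q <- picks p.2) F p.1 q.1 q.2 =
  \sum_(p <- picks s) \sum_(q <- picks p.2) F q.1 p.1 q.2.
Proof.
elim: s F => [|x s IH] F /=; first by rewrite !big_nil.
rewrite !big_cons !big_map /=.
under [X in _ + X = _]eq_bigr => p _ do rewrite big_cons big_map /=.
under [X in _ = _ + X]eq_bigr => p _ do rewrite big_cons big_map /=.
rewrite !big_split /= (IH (fun a b r => F a b (x :: r))) !addrA; congr (_ + _).
exact: addrC.
Qed.

(** The remainder left by [picks] depends on the position of the item.  A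
    summand that is insensitive to the order of the remainder can be computed
    with [rem] instead, and a sum over the items does not depend on their order. *)
Lemma big_picks_perm (V : nmodType) (T : eqType) (s t : seq T) (F : T -> seq T -> V) :
  perm_eq s t ->
  (forall a u v, perm_eq (a :: u) s -> perm_eq u v -> F a u = F a v) ->
  \sum_(p <- picks s) F p.1 p.2 = \sum_(p <- picks t) F p.1 p.2.
Proof.
move=> st Fperm.
have rem_picks r : perm_eq r s ->
    \sum_(p <- picks r) F p.1 p.2 = \sum_(a <- r) F a (rem a r).
  move=> rs; rewrite -[in RHS](map_picks1 r) big_map map_picks1.
  apply: eq_big_seq => p pr; have pp := perm_picks pr.
  apply: Fperm; first exact: (perm_trans pp rs).
  rewrite -(perm_cons p.1); apply: (perm_trans pp).
  by rewrite perm_to_rem // -(perm_mem pp) mem_head.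
rewrite !rem_picks // 1?perm_sym // (perm_big t) //=; apply: eq_big_seq => a ta.
have sa : a \in s by rewrite (perm_mem st).
apply: Fperm; first by rewrite perm_sym perm_to_rem.
rewrite -(perm_cons a); apply: perm_trans (perm_to_rem ta).
by rewrite perm_sym; apply: perm_trans (perm_to_rem sa); rewrite perm_sym.
Qed.

(** * Joining two legs of a diagram *)

Definition fuse (e f g : nat) : nat := if g == f then e else g.

(** The edges [e] and [f] end in stubs that are not among the legs of [D]; when
    they are one edge, joining its two stubs makes a circle. *)
Definition weld (X : Type) (e f : nat) (D : diagram X) : diagram X :=
  Diagram (map (ren_vertex (fuse e f)) (verts D))
          (map (ren_leg (fuse e f)) (legs D)) (circles D + (e == f)).

Lemma ends_relabel X phi vs (L : seq (X * nat)) c c' :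
  ends (Diagram (map (ren_vertex phi) vs) (map (ren_leg phi) L) c) =
  map phi (ends (Diagram vs L c')).
Proof.
rewrite /ends /= map_cat map_flatten -!map_comp; congr (flatten _ ++ _).
Qed.

Lemma eq_ren_vertex phi psi vs :
  {in flatten (map vertex_ends vs), phi =1 psi} ->
  map (ren_vertex phi) vs = map (ren_vertex psi) vs.
Proof.
elim: vs => [|[[a b] c] vs IH] //= h; rewrite IH => [|g gv]; last first.
  by apply: h; rewrite !inE gv !orbT.
by rewrite /ren_vertex /= !h // !inE eqxx ?orbT.
Qed.

Lemma eq_ren_leg X phi psi (L : seq (X * nat)) :
  {in map snd L, phi =1 psi} -> map (ren_leg phi) L = map (ren_leg psi) L.
Proof.
elim: L => [|[x e] L IH] //= h; rewrite IH => [|g gv]; last first.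
  by apply: h; rewrite !inE gv !orbT.
by rewrite /ren_leg /= h // !inE eqxx.
Qed.

Lemma map_ren_vertex_id vs : map (ren_vertex id) vs = vs.
Proof. by rewrite (eq_map (_ : _ =1 id)) ?map_id // => -[[]]. Qed.

Lemma map_ren_leg_id X (L : seq (X * nat)) : map (ren_leg id) L = L.
Proof. by rewrite (eq_map (_ : _ =1 id)) ?map_id // => -[]. Qed.

Lemma rotation_refl v : rotation v v.
Proof. by case: v => [[a b] c]; rewrite /= inE eqxx. Qed.

Lemma all2_rotation_refl vs : all2 rotation vs vs.
Proof. by elim: vs => //= v vs ->; rewrite rotation_refl. Qed.

Lemma rotation_ren phi v w : rotation v w -> rotation (ren_vertex phi v) (ren_vertex phi w).
Proof.
case: v => [[a b] c]; rewrite /= !inE => /or3P[] /eqP -> /=;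
by rewrite /ren_vertex /= eqxx ?orbT.
Qed.

Lemma all2_rotation_ren phi vs ws : all2 rotation vs ws ->
  all2 rotation (map (ren_vertex phi) vs) (map (ren_vertex phi) ws).
Proof.
by elim: vs ws => [|v vs IH] [|w ws] //= /andP[/(@rotation_ren phi) h /IH ->]; rewrite andbT.
Qed.

(** Isomorphisms that respect the order of the legs: sums defined by recursion
    on the sequence of legs are visibly invariant under these. *)
Definition leg_iso (X : Type) (phi : nat -> nat) (D D' : diagram X) : Prop :=
  [/\ {in ends D &, injective phi},
      exists2 vs, perm_eq vs (map (ren_vertex phi) (verts D))
                & all2 rotation vs (verts D'),
      legs D' = map (ren_leg phi) (legs D)
    & circles D' = circles D].

Lemma leg_iso_iso (X : eqType) phi (D D' : diagram X) :
  leg_iso phi D D' -> diagram_iso D D'.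
Proof. by case=> h1 h2 h3 h4; exists phi; split=> //; rewrite h3. Qed.

(** Two successions of joins give isomorphic diagrams when they identify the
    same edges: the kernel of a renaming determines its result up to
    isomorphism, so that isomorphisms need not be exhibited. *)
Lemma leg_iso_kernel (X : Type) rho sigma (D : diagram X) c c' :
  {in ends D &, forall g h, (rho g == rho h) = (sigma g == sigma h)} -> c = c' ->
  exists phi, leg_iso phi
    (Diagram (map (ren_vertex rho) (verts D)) (map (ren_leg rho) (legs D)) c)
    (Diagram (map (ren_vertex sigma) (verts D)) (map (ren_leg sigma) (legs D)) c').
Proof.
move=> ker ->; set E := ends D in ker *.
(* [phi] sends a new name [z] to the name that [sigma] gives to some edge named [z] by [rho] *)
pose phi z := sigma (nth 0%N E (find (fun g => rho g == z) E)).
have phiE g : g \in E -> phi (rho g) = sigma g.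
  move=> gE; apply/eqP; rewrite /phi.
  have hE : has (fun g' => rho g' == rho g) E by apply/hasP; exists g.
  by rewrite -ker ?(nth_find 0%N hE) // mem_nth // -has_find.
have phiv : {in flatten (map vertex_ends (verts D)), phi \o rho =1 sigma}.
  by move=> g gv; apply: phiE; rewrite mem_cat gv.
have phil : {in map snd (legs D), phi \o rho =1 sigma}.
  by move=> g gv; apply: phiE; rewrite mem_cat gv orbT.
exists phi; split=> //=.
- rewrite (ends_relabel _ _ _ _ c) => _ _ /mapP[g gE ->] /mapP[h hE ->].
  rewrite !(phiE g) ?(phiE h) // => /eqP.
  by rewrite -ker // => /eqP.
- exists (map (ren_vertex sigma) (verts D)); last exact: all2_rotation_refl.
  by rewrite -map_comp -(eq_ren_vertex phiv).
- by rewrite -map_comp -(eq_ren_leg phil).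
Qed.

Lemma leg_iso_renumber (X : Type) rho (D : diagram X) : injective rho ->
  exists phi, leg_iso phi
    (Diagram (map (ren_vertex rho) (verts D)) (map (ren_leg rho) (legs D)) (circles D)) D.
Proof.
move=> inj; have ker : {in ends D &, forall g h, (rho g == rho h) = (id g == id h)}.
  by move=> g h _ _; rewrite (inj_eq inj).
have [phi] := leg_iso_kernel ker (erefl (circles D)).
by rewrite map_ren_vertex_id map_ren_leg_id => iso; exists phi; case: (D) iso.
Qed.

Lemma leg_iso_weld (X : eqType) phi (D D' : diagram X) p q L :
  leg_iso phi D D' -> perm_eq (p :: q :: L) (legs D) ->
  leg_iso phi (weld p.2 q.2 (Diagram (verts D) L (circles D)))
              (weld (phi p.2) (phi q.2)
                 (Diagram (verts D') (map (ren_leg phi) L) (circles D'))).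
Proof.
case: D D' => [vs L0 c] [vs' L0' c'] [/= inj [vs0 pvs rvs] _ ->] pL.
have mem0 g : g \in [:: p.2, q.2 & map snd L] -> g \in ends (Diagram vs L0 c).
  by rewrite mem_cat /= -(perm_mem (perm_map snd pL)) => ->; rewrite orbT.
have memp : p.2 \in ends (Diagram vs L0 c) by rewrite mem0 // mem_head.
have memq : q.2 \in ends (Diagram vs L0 c) by rewrite mem0 // !inE eqxx orbT.
have fuseE g : g \in ends (Diagram vs L0 c) ->
    phi (fuse p.2 q.2 g) = fuse (phi p.2) (phi q.2) (phi g).
  by move=> gE; rewrite /fuse (inj_in_eq inj) //; case: ifP.
have sub g : g \in ends (Diagram vs L c) -> g \in ends (Diagram vs L0 c).
  rewrite mem_cat /= => /orP[gv|gv]; first by rewrite mem_cat gv.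
  by rewrite mem0 // !inE gv !orbT.
split=> /=.
- rewrite (ends_relabel _ _ _ _ c) => _ _ /mapP[g gE ->] /mapP[h hE ->].
  move=> /inj E; apply: E.
    by rewrite /fuse; case: ifP => // _; apply: sub.
  by rewrite /fuse; case: ifP => // _; apply: sub.
- exists (map (ren_vertex (fuse (phi p.2) (phi q.2))) vs0); last exact: all2_rotation_ren.
  have := perm_map (ren_vertex (fuse (phi p.2) (phi q.2))) pvs; rewrite -!map_comp.
  move/perm_trans; apply; rewrite (@eq_ren_vertex (phi \o fuse p.2 q.2)
    (fuse (phi p.2) (phi q.2) \o phi)) // => g gv /=.
  by rewrite fuseE // mem_cat gv.
- rewrite -!map_comp (@eq_ren_leg _ (phi \o fuse p.2 q.2)
    (fuse (phi p.2) (phi q.2) \o phi)) // => g gv /=.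
  by rewrite fuseE // mem0 // !inE gv !orbT.
- by rewrite (inj_in_eq inj).
Qed.

Lemma fuse_ker e f g h : (fuse e f g == fuse e f h) =
  (g == h) || ((g == e) || (g == f)) && ((h == e) || (h == f)).
Proof.
rewrite /fuse; do !case: eqP => //=; intros; subst; congruence.
Qed.

Lemma weld_flip (X : Type) e f (D : diagram X) :
  exists phi, leg_iso phi (weld e f D) (weld f e D).
Proof.
apply: leg_iso_kernel; last by rewrite eq_sym.
by move=> g h _ _; rewrite !fuse_ker [(g == f) || _]orbC [(h == f) || _]orbC.
Qed.

(** The order of two joins is immaterial: either way the edges [e] and [a] are
    identified, and so are [f] and [b], and the same number of circles appears.
    The names of the ends of the second join are those after the first one. *)
Lemma weld_swap (X : Type) e a f b (D : diagram X) :
  exists phi, leg_iso phi (weld (fuse e a f) (fuse e a b) (weld e a D))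
                          (weld (fuse f b e) (fuse f b a) (weld f b D)).
Proof.
have := @leg_iso_kernel X (fuse (fuse e a f) (fuse e a b) \o fuse e a)
  (fuse (fuse f b e) (fuse f b a) \o fuse f b) D
  (circles D + (e == a) + (fuse e a f == fuse e a b))
  (circles D + (f == b) + (fuse f b e == fuse f b a)).
rewrite /weld /= -!map_comp; apply.
- move=> g h _ _ /=; rewrite !fuse_ker; do !case: eqP => //=; intros; subst; congruence.
- rewrite !fuse_ker; lia.
Qed.

(** * Well-formed diagrams *)

Definition twice (s : seq nat) : bool := all (fun e => count_mem e s == 2%N) s.

Lemma wfE X (D : diagram X) : wf D = twice (ends D). Proof. by []. Qed.

Lemma twiceP s : reflect (forall e, e \in s -> count_mem e s = 2%N) (twice s).
Proof. by apply: (iffP allP) => h e /h /eqP. Qed.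

Lemma perm_twice s t : perm_eq s t -> twice s = twice t.
Proof.
move=> st; rewrite /twice (perm_all _ st); apply: eq_all => e.
by rewrite (seq.permP st).
Qed.

Lemma twice_inj phi s : {in s &, injective phi} -> twice (map phi s) = twice s.
Proof.
move=> inj; rewrite /twice all_map; apply: eq_in_all => e es /=.
rewrite count_map; congr (_ == _); apply: eq_in_count => f fs /=.
by rewrite (inj_in_eq inj).
Qed.

(** Joining two stubs removes one occurrence of each of the two names and then
    identifies the names, so that the common name again occurs twice. *)
Lemma twice_fuse e f s : twice (e :: f :: s) -> twice (map (fuse e f) s).
Proof.
move=> /twiceP h; apply/twiceP => _ /mapP[g gs ->]; rewrite count_map.
have he := h e (mem_head _ _); have hf : count_mem f (e :: f :: s) = 2%N.
  by apply: h; rewrite !inE eqxx orbT.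
have hg : count_mem g (e :: f :: s) = 2%N by apply: h; rewrite !inE gs !orbT.
move: gs; rewrite -has_pred1 has_count.
case: (eqVneq e f) => [ef|nef].
  subst f; have fee k : fuse e e k = k by rewrite /fuse; case: eqP.
  rewrite fee (@eq_count _ _ (pred1 g)) => [|k]; last by rewrite /= fee.
  move: he hg => /=; rewrite eqxx; case: (eqVneq e g) => [->|_]; lia.
move: he hf hg => /=; rewrite !eqxx /= [f == e]eq_sym (negPf nef) => he hf hg gs.
have h2 : (g == e) || (g == f) -> count (preim (fuse e f) (pred1 e)) s = 2%N.
  move=> _; rewrite (@eq_count _ _ (predU (pred1 e) (pred1 f))); last first.
    by move=> k; rewrite /= /fuse; case: (k == f); rewrite ?orbT ?eqxx ?orbF.
  have := count_predUI (pred1 e) (pred1 f) s.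
  have -> : count (predI (pred1 e) (pred1 f)) s = 0%N.
    rewrite (@eq_count _ _ pred0) ?count_pred0 // => k /=.
    by case: (eqVneq k e) => // ->; apply: negPf.
  by rewrite addn0 => ->; move: he hf; rewrite !add0n !add1n => -[->] -[->].
rewrite /fuse; case: (eqVneq g f) => [gf|gf]; first by apply: h2; rewrite gf eqxx orbT.
case: (eqVneq g e) => [ge|ge]; first by rewrite ge; apply: h2; rewrite ge eqxx.
rewrite -[RHS]hg [e == g]eq_sym [f == g]eq_sym (negPf ge) (negPf gf) !add0n.
apply: eq_count => k /=; case: (eqVneq k f) => // ->.
by rewrite [e == g]eq_sym [f == g]eq_sym (negPf ge) (negPf gf).
Qed.

Lemma rotation_ends v w : rotation v w -> perm_eq (vertex_ends w) (vertex_ends v).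
Proof.
case: v => [[a b] c]; rewrite /= !inE => /or3P[] /eqP -> //=; rewrite /vertex_ends /=.
  by rewrite (perm_catC [:: b; c] [:: a]).
by rewrite (perm_catC [:: c] [:: a; b]).
Qed.

Lemma iso_ends (X : eqType) phi (D D' : diagram X) vs :
  perm_eq vs (map (ren_vertex phi) (verts D)) -> all2 rotation vs (verts D') ->
  perm_eq (legs D') (map (ren_leg phi) (legs D)) ->
  perm_eq (ends D') (map phi (ends D)).
Proof.
move=> pvs rvs pL; rewrite /ends map_cat; apply: perm_cat; last first.
  by have := perm_map snd pL; rewrite -!map_comp.
have := perm_flatten (perm_map vertex_ends pvs).
rewrite map_flatten -!map_comp => /(perm_trans _); apply.
elim: vs (verts D') rvs {pvs} => [|v vs IH] [|w ws] //= /andP[vw /IH h].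
exact: perm_cat (rotation_ends vw) h.
Qed.

Lemma iso_wf (X : eqType) (D D' : diagram X) : diagram_iso D D' -> wf D = wf D'.
Proof.
case=> phi [inj [vs pvs rvs] pL _]; rewrite !wfE (perm_twice (iso_ends pvs rvs pL)).
by rewrite twice_inj.
Qed.

Lemma perm_ends_legs X (L M : seq (X * nat)) vs c c' : perm_eq (map snd L) (map snd M) ->
  perm_eq (ends (Diagram vs L c)) (ends (Diagram vs M c')).
Proof. by move=> LM; rewrite /ends /= perm_cat2l. Qed.

Lemma wf_perm (X : eqType) (L M : seq (X * nat)) vs c c' : perm_eq L M ->
  wf (Diagram vs L c) = wf (Diagram vs M c').
Proof. by move=> LM; rewrite !wfE; apply/perm_twice/perm_ends_legs/perm_map. Qed.

Lemma wf_weld (X : eqType) (p q : X * nat) L vs c :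
  wf (Diagram vs (p :: q :: L) c) -> wf (weld p.2 q.2 (Diagram vs L c)).
Proof.
rewrite !wfE (ends_relabel _ _ _ _ c) => h; apply: twice_fuse.
rewrite (@perm_twice _ (ends (Diagram vs (p :: q :: L) c))) //.
by rewrite /ends /= perm_sym (perm_catCA _ [:: p.2; q.2]).
Qed.

Lemma wf_weld_perm (X : eqType) (p q : X * nat) L M vs c : perm_eq (p :: q :: L) M ->
  wf (Diagram vs M c) -> wf (weld p.2 q.2 (Diagram vs L c)).
Proof. by move=> pLM; rewrite -(wf_perm _ c _ pLM) => /wf_weld. Qed.

(** * Sums over the matchings of the legs *)

Section Wick.
Variables (K : fieldType) (V : lmodType K) (ev : diagram void -> V).
Hypothesis ev_iso : forall D D' : diagram void, diagram_iso D D' -> ev D = ev D'.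
Variable X : finType.
Implicit Types (D : diagram X) (L : seq (X * nat)) (w : X -> X -> K).

(** The first leg [a] chooses its partner [p.1] among the other legs; a set of
    legs of odd size has no matching.  The number [n] is fuel. *)
Fixpoint wick_rec n w D : V :=
  if legs D is a :: L then
    if n is n'.+1 then
      \sum_(p <- picks L) w a.1 p.1.1 *:
         wick_rec n' w (weld a.2 p.1.2 (Diagram (verts D) p.2 (circles D)))
    else 0
  else ev (Diagram (verts D) [::] (circles D)).

Definition wick w D : V := wick_rec (size (legs D)) w D.

Lemma wick_recE n n' w D : (size (legs D) <= n)%N -> (size (legs D) <= n')%N ->
  wick_rec n w D = wick_rec n' w D.
Proof.
elim: n n' D => [|n IH] [|n'] [vs [|a L] c] //= sn sn'.
apply: eq_big_seq => p pL; congr (_ *: _).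
by apply: IH; rewrite size_map (leq_size_picks pL) // ltnW.
Qed.

Lemma wick_nil w vs c : wick w (Diagram vs [::] c) = ev (Diagram vs [::] c).
Proof. by []. Qed.

Lemma wick_cons w vs a L c :
  wick w (Diagram vs (a :: L) c) =
  \sum_(p <- picks L) w a.1 p.1.1 *: wick w (weld a.2 p.1.2 (Diagram vs p.2 c)).
Proof.
rewrite /wick /=; apply: eq_big_seq => p pL; congr (_ *: _).
by apply: wick_recE => //=; rewrite size_map (leq_size_picks pL).
Qed.

Lemma wick_leg_iso w phi D D' : leg_iso phi D D' -> wick w D = wick w D'.
Proof.
elim: {D}(size _) {-2}D D' phi (leqnn (size (legs D))) => [|n IH] D D' phi.
  case: D D' => [vs [|a L] c] [vs' L' c'] //= _ [inj [vs0 p r] /= -> /= ->].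
  rewrite !wick_nil; apply: ev_iso; exists phi; split=> //=.
  by exists vs0.
case: D D' => [vs [|a L] c] [vs' L' c'] sL iso.
  case: iso => inj [vs0 p r] /= -> /= ->.
  rewrite !wick_nil; apply: ev_iso; exists phi; split=> //=.
  by exists vs0.
have [_ _ /= eL ec] := iso; subst L' c'.
rewrite !wick_cons picks_map big_map; apply: eq_big_seq => p pL /=; congr (_ *: _).
have pLa : perm_eq (a :: p.1 :: p.2) (a :: L) by rewrite perm_cons perm_picks.
apply: IH (leg_iso_weld iso pLa).
by rewrite size_map (leq_size_picks pL) // ltnW.
Qed.

Lemma wick_weldC w e f D : wick w (weld e f D) = wick w (weld f e D).
Proof. by have [phi /wick_leg_iso] := weld_flip e f D. Qed.

Section Symmetric.
Variable w : X -> X -> K.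
Hypothesis w_sym : forall x y, w x y = w y x.

(** It suffices to exchange the two legs at the head.  Either they are partners,
    and the weight is symmetric, or they choose two other legs as partners, in
    which case the two joins commute. *)
Lemma wick_perm vs L M c :
  perm_eq L M -> wick w (Diagram vs L c) = wick w (Diagram vs M c).
Proof.
elim: {L}(size _) vs {-2}L M c (leqnn (size L)) => [|n IH] vs L M c.
  by case: L => // _; rewrite perm_sym => /perm_nilP ->.
move=> sL LM.
have head a L1 L2 : (size L1 <= n)%N -> perm_eq L1 L2 ->
    wick w (Diagram vs (a :: L1) c) = wick w (Diagram vs (a :: L2) c).
  move=> s1 p12; rewrite !wick_cons.
  pose F (b : X * nat) u := w a.1 b.1 *: wick w (weld a.2 b.2 (Diagram vs u c)).
  rewrite (big_picks_perm (F := F) p12) // => b u v bu uv; congr (_ *: _).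
  apply: IH; last exact: perm_map.
  by rewrite size_map; have := perm_size bu => /= su; lia.
have swap a b L1 : (size L1 < n)%N ->
    wick w (Diagram vs (a :: b :: L1) c) = wick w (Diagram vs (b :: a :: L1) c).
  move=> s1; rewrite !wick_cons /= !big_cons !big_map /= w_sym wick_weldC; congr (_ + _).
  pose F (p q : X * nat) r := w a.1 p.1 *: (w b.1 q.1 *:
    wick w (weld (fuse a.2 p.2 b.2) (fuse a.2 p.2 q.2) (weld a.2 p.2 (Diagram vs r c)))).
  transitivity (\sum_(p <- picks L1) \sum_(q <- picks p.2) F p.1 q.1 q.2).
    apply: eq_bigr => p _; rewrite wick_cons picks_map big_map scaler_sumr.
    by apply: eq_bigr.
  rewrite big_picks2C; apply: eq_bigr => p _.
  rewrite wick_cons picks_map big_map scaler_sumr; apply: eq_bigr => q _ /=.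
  rewrite /F !scalerA mulrC; congr (_ *: _).
  by have [phi /wick_leg_iso ->] := weld_swap a.2 q.1.2 b.2 p.1.2 (Diagram vs q.2 c).
case: L M sL LM => [|a L1] [|b M1] //; try by move=> _ /perm_size.
move=> sL; have [->|ab LM] := eqVneq a b; first by rewrite perm_cons; apply: head.
have bL : b \in L1.
  by have := perm_mem LM b; rewrite !inE eqxx eq_sym (negPf ab).
have pL := perm_to_rem bL.
have sr : (size (rem b L1) < n)%N by have := perm_size pL; rewrite /= in sL *; lia.
rewrite (head a _ _ _ pL) // swap //; apply: head => //.
rewrite -(perm_cons b) -(permPr LM) -(permPl (_ : perm_eq [:: a, b & rem b L1] _)).
  by rewrite perm_cons perm_sym.
by rewrite -[X in perm_eq X _]/([:: a] ++ [:: b] ++ _) perm_catCA.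
Qed.

Lemma wick_iso D D' : diagram_iso D D' -> wick w D = wick w D'.
Proof.
case: D D' => [vs L c] [vs' L' c'] [phi [inj vsP pL /= ->]].
rewrite [RHS](wick_perm _ _ pL); apply: (@wick_leg_iso _ phi); split=> //.
Qed.

(** Since any leg may be put first, counting the matchings with a
    distinguished leg multiplies their sum by the number of legs. *)
Lemma sum_wick_heads vs L c :
  \sum_(p <- picks L) wick w (Diagram vs (p.1 :: p.2) c) =
  (size L)%:R *: wick w (Diagram vs L c).
Proof.
transitivity (\sum_(p <- picks L) wick w (Diagram vs L c)).
  by apply: eq_big_seq => p /perm_picks; apply: wick_perm.
rewrite big_const_seq count_predT iter_addr_0 scaler_nat; congr (_ *+ _).
by rewrite -[in RHS](map_picks1 L) size_map.
Qed.

End Symmetric.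

(** The gluing of the struts of the word [s] to all the legs of [D]: a strut with
    ends [x] and [y] joins a leg labelled [x] with a leg labelled [y]. *)
Fixpoint contract (s : seq (X * X)) D : V :=
  if s is (x, y) :: s' then
    \sum_(p <- picks (legs D) | p.1.1 == x) \sum_(q <- picks p.2 | q.1.1 == y)
      contract s' (weld p.1.2 q.1.2 (Diagram (verts D) q.2 (circles D)))
  else if legs D is [::] then ev (Diagram (verts D) [::] (circles D)) else 0.

Lemma contract_leg_iso s phi D D' : leg_iso phi D D' -> contract s D = contract s D'.
Proof.
elim: s phi D D' => [|[x y] s IH] phi [vs L c] [vs' L' c'] iso /=.
  case: iso => /= inj [vs0 p r] -> ->; case: L inj => //= inj.
  by apply: ev_iso; exists phi; split=> //=; exists vs0.
have [_ _ /= eL ec] := iso; subst L' c'.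
rewrite picks_map big_map big_seq_cond [RHS]big_seq_cond /=.
apply: eq_bigr => p /andP[pL _].
rewrite picks_map big_map big_seq_cond [RHS]big_seq_cond /=.
apply: eq_bigr => q /andP[qL _].
apply/IH/(leg_iso_weld iso); apply: perm_trans (perm_picks pL).
by rewrite perm_cons perm_picks.
Qed.

Lemma big_legs_label (U : nmodType) (F : X -> (X * nat) * seq (X * nat) -> U) L :
  \sum_x \sum_(p <- picks L | p.1.1 == x) F x p = \sum_(p <- picks L) F p.1.1 p.
Proof.
rewrite (exchange_big_dep xpredT) //=; apply: eq_bigr => p _.
by rewrite (big_pred1 p.1.1) // => x; rewrite eq_sym.
Qed.

(** Linear combination of a function over the words of [k] struts, with the
    coefficients of [(\sum_(x, y) c x y) ^ k] *)
Fixpoint strut_words c k (g : seq (X * X) -> V) : V :=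
  if k is k'.+1 then
    \sum_x \sum_y c x y *: strut_words c k' (fun s => g ((x, y) :: s))
  else g [::].

Lemma strut_words_sum c k I (r : seq I) (P : pred I) g :
  strut_words c k (fun s => \sum_(i <- r | P i) g i s) =
  \sum_(i <- r | P i) strut_words c k (g i).
Proof.
elim: k g => [|k IH] g //=.
rewrite [RHS]exchange_big /=; apply: eq_bigr => x _.
rewrite [RHS]exchange_big /=; apply: eq_bigr => y _.
by rewrite IH scaler_sumr.
Qed.

(** The first strut selects an ordered pair of legs and the remaining ones, by
    induction, match the other legs; so each matching is counted once for
    each choice of one of the [2k] legs, as in [sum_wick_heads]. *)
Lemma contract_exp c k D : (forall x y, c x y = c y x) ->
  strut_words c k (fun s => contract s D) =
  if size (legs D) == k.*2 then (2 ^ k * k`!)%:R *: wick c D else 0.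
Proof.
move=> c_sym; elim: k D => [|k IH] [vs L c0] /=.
  by case: L => [|a L] //=; rewrite scale1r.
pose W (p q : (X * nat) * seq (X * nat)) :=
  strut_words c k (contract^~ (weld p.1.2 q.1.2 (Diagram vs q.2 c0))).
transitivity (\sum_(p <- picks L) \sum_(q <- picks p.2) c p.1.1 q.1.1 *: W p q).
  rewrite -(big_legs_label (fun x p => \sum_(q <- picks p.2) c x q.1.1 *: W p q)).
  apply: eq_bigr => x _.
  transitivity (\sum_y \sum_(p <- picks L | p.1.1 == x)
      \sum_(q <- picks p.2 | q.1.1 == y) c x y *: W p q).
    apply: eq_bigr => y _; rewrite strut_words_sum scaler_sumr; apply: eq_bigr => p _.
    by rewrite strut_words_sum scaler_sumr.
  rewrite exchange_big; apply: eq_bigr => p _.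
  by rewrite (big_legs_label (fun y q => c x y *: W p q)).
have WE p q : p \in picks L -> q \in picks p.2 ->
    W p q = if size L == k.*2.+2
      then (2 ^ k * k`!)%:R *: wick c (weld p.1.2 q.1.2 (Diagram vs q.2 c0)) else 0.
  move=> pL qL; rewrite /W IH /= size_map -[in RHS](size_picks pL) -(size_picks qL).
  by rewrite !eqSS.
transitivity (\sum_(p <- picks L) \sum_(q <- picks p.2) c p.1.1 q.1.1 *:
    (if size L == k.*2.+2
     then (2 ^ k * k`!)%:R *: wick c (weld p.1.2 q.1.2 (Diagram vs q.2 c0)) else 0)).
  by apply: eq_big_seq => p pL; apply: eq_big_seq => q qL; rewrite WE.
rewrite doubleS.
case: eqP => sL; last first.
  by rewrite big1 // => p _; rewrite big1 // => q _; rewrite scaler0.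
transitivity (\sum_(p <- picks L) (2 ^ k * k`!)%:R *: wick c (Diagram vs (p.1 :: p.2) c0)).
  apply: eq_bigr => p _; rewrite wick_cons scaler_sumr; apply: eq_bigr => q _.
  by rewrite !scalerA mulrC.
rewrite -scaler_sumr sum_wick_heads // scalerA -natrM sL; congr (_%:R *: _).
by rewrite factS expnS -mul2n; lia.
Qed.
End Wick.

(** * Vanishing in high degree *)

Lemma foldl_join_comp ps sigma rho c :
  foldl join_step (sigma \o rho, c) ps =
  let s := foldl join_step (sigma, c) [seq (rho p.1, rho p.2) | p <- ps] in
  (s.1 \o rho, s.2).
Proof.
elim: ps sigma c => [|[e f] ps IH] sigma c //=.
pose t := join_step (sigma, c) (rho e, rho f).
have -> : join_step (sigma \o rho, c) (e, f) = (t.1 \o rho, t.2).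
  by rewrite /t /join_step /=; case: ifP.
by rewrite IH -/t -surjective_pairing.
Qed.

(** Joining the first pair at once and renaming the remaining pairs accordingly
    is the recursion followed by [wick]. *)
Lemma join_legs_cons e f ps vs c :
  join_legs ((e, f) :: ps) vs c =
  join_legs [seq (fuse e f p.1, fuse e f p.2) | p <- ps]
            (map (ren_vertex (fuse e f)) vs) (c + (e == f)).
Proof.
rewrite /join_legs /=.
have -> : join_step (id, c) (e, f) = (id \o fuse e f, (c + (e == f))%N).
  rewrite /join_step /=; case: eqVneq => [->|_]; last by rewrite addn0.
  rewrite addn1; congr pair; apply: functional_extensionality_dep => k.
  by rewrite /= /fuse; case: eqP.
by rewrite foldl_join_comp /= -map_comp.
Qed.

Lemma matchings_rec_map f n s :
  matchings_rec n (map f s) =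
  [seq [seq (f p.1, f p.2) | p <- ps] | ps <- matchings_rec n s].
Proof.
elim: n s => [|n IH] [|a s] //=.
rewrite picks_map -map_comp map_flatten -map_comp; congr flatten.
by apply: eq_map => p /=; rewrite IH -!map_comp.
Qed.

Definition occ (X : eqType) (x : X) (L : seq (X * nat)) : nat :=
  count (fun a => a.1 == x) L.

Lemma occ_ren (X : eqType) (x : X) phi L : occ x (map (ren_leg phi) L) = occ x L.
Proof. by rewrite /occ count_map; apply: eq_count. Qed.

Lemma occ_perm (X : eqType) (x : X) L M : perm_eq L M -> occ x L = occ x M.
Proof. by move/seq.permP; apply. Qed.

Lemma sum_occ (X : finType) (L : seq (X * nat)) : \sum_x occ x L = size L.
Proof.
elim: L => [|a L IH] /=; first by rewrite big1.
rewrite big_split /= -[RHS]add1n; congr (_ + _)%N; last exact: IH.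
by rewrite (bigD1 a.1) //= eqxx big1 // => x; rewrite eq_sym => /negPf ->.
Qed.

Section Vanishing.
Variables (K : fieldType) (V : lmodType K) (ev : diagram void -> V) (m : nat).
Hypothesis ev_iso : forall D D' : diagram void, diagram_iso D D' -> ev D = ev D'.
Hypothesis ev_P : forall D : diagram unit, wf D -> size (legs D) = (2 * m + 2)%N ->
  \sum_(ps <- matchings (map snd (legs D))) ev (join_legs ps (verts D) (circles D)) = 0.
Variable X : finType.
Implicit Types (D : diagram X) (L : seq (X * nat)).

Definition delta (x y : X) : K := (x == y)%:R.

Lemma delta_sym x y : delta x y = delta y x.
Proof. by rewrite /delta eq_sym. Qed.

Lemma delta_refl x : delta x x = 1.
Proof. by rewrite /delta eqxx. Qed.

Lemma delta_neq x y : x != y -> delta x y = 0.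
Proof. by rewrite /delta => /negPf ->. Qed.

(** When all legs carry the same label, [wick] is the sum in the relation
    P_{m+1}. *)
Lemma wick_matchings (w : X -> X -> K) x vs L c : w x x = 1 ->
  all (fun a => a.1 == x) L ->
  wick ev w (Diagram vs L c) =
  \sum_(ps <- matchings (map snd L)) ev (join_legs ps vs c).
Proof.
move=> wx; rewrite /matchings size_map.
have nilE vs' c' : wick ev w (Diagram vs' [::] c') =
    \sum_(ps <- [:: [::]]) ev (join_legs ps vs' c').
  by rewrite wick_nil big_seq1 /join_legs /= map_ren_vertex_id.
suff H n L' vs' c' : (size L' <= n)%N -> all (fun a => a.1 == x) L' ->
    wick ev w (Diagram vs' L' c') =
    \sum_(ps <- matchings_rec n (map snd L')) ev (join_legs ps vs' c') by exact: H.
elim: n L' vs' c' => [|n IH] [|a L'] vs' c'; rewrite ?nilE //= => sL.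
move=> /andP[/eqP ax allL]; rewrite wick_cons big_flatten big_map picks_map big_map.
apply: eq_big_seq => p pL /=; rewrite big_map.
have := allL; rewrite -(perm_all _ (perm_picks pL)) /= => /andP[/eqP px allp].
rewrite ax px wx scale1r /weld /= IH; first last.
- by rewrite all_map; apply: sub_all allp.
- by rewrite size_map (leq_size_picks pL) // ltnW.
rewrite -map_comp (map_comp (fuse a.2 p.1.2) snd) matchings_rec_map big_map.
by apply: eq_bigr => b _; rewrite join_legs_cons.
Qed.

Lemma wick_odd w vs L c : odd (size L) -> wick ev w (Diagram vs L c) = 0.
Proof.
elim: {L}(size L) {-2}L vs c (leqnn (size L)) => [|n IH] [|a L] vs c //= sL.
move=> oL; rewrite wick_cons big_seq big1 // => p pL; rewrite IH ?scaler0 //.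
  by rewrite size_map (leq_size_picks pL) // ltnW.
by rewrite size_map; move: oL; rewrite -(size_picks pL) /= negbK.
Qed.

(** A leg with another label may be put first; its partner has this other label
    as well, so that the number of legs labelled [x] does not change.  Once only
    the label [x] remains, joining the first leg to any other one leaves two
    legs less, until [2m + 2] legs remain and P_{m+1} applies. *)
Lemma wick_occ_vanish x vs L c : wf (Diagram vs L c) -> (2 * m < occ x L)%N ->
  wick ev delta (Diagram vs L c) = 0.
Proof.
elim: {L}(size L) {-2}L vs c (leqnn (size L)) => [|n IH] L vs c sL wfL mL.
  by case: L sL mL {wfL}.
have [allL|] := boolP (all (fun a => a.1 == x) L).
  have [oL|eL] := boolP (odd (size L)); first exact: wick_odd.
  have occL : occ x L = size L by apply/eqP; rewrite -all_count.
  have [s2|s2] := eqVneq (size L) (2 * m + 2)%N.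
    rewrite (@wick_matchings _ x) //; last by rewrite /delta eqxx.
    have := @ev_P (Diagram vs (map (fun a => (tt, a.2)) L) c).
    rewrite /= size_map -map_comp; apply=> //.
    rewrite wfE (@perm_twice _ (ends (Diagram vs L c))) //; apply: perm_cat => //=.
    by rewrite -map_comp.
  case: L sL wfL mL allL eL occL s2 => [|a L] // sL wfL mL allL eL occL s2.
  rewrite wick_cons big_seq big1 // => p pL; rewrite IH ?scaler0 //.
  - by rewrite size_map (leq_size_picks pL) // ltnW.
  - by apply: (wf_weld_perm _ wfL); rewrite perm_cons perm_picks.
  rewrite occ_ren.
  have s1 := size_picks pL; rewrite occL /= in mL s2 eL; rewrite /= in eL s2 mL.
  have pall : all (fun a => a.1 == x) p.2.
    by move: allL; rewrite /= -(perm_all _ (perm_picks pL)) /= => /and3P[].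
  have -> : occ x p.2 = size p.2 by apply/eqP; rewrite -all_count.
  rewrite -s1 in mL s2 eL; move: mL s2 eL; set k := size p.2; rewrite /= negbK.
  by move=> *; lia.
case/allPn => a aL nax; have pL := perm_to_rem aL.
rewrite (wick_perm ev_iso delta_sym vs c pL) wick_cons big_seq big1 // => p pr.
have [ap|nap] := eqVneq a.1 p.1.1; last by rewrite /delta (negPf nap) scale0r.
have pp : perm_eq (a :: p.1 :: p.2) L.
  by rewrite (permPr pL) perm_cons perm_picks.
rewrite IH ?scaler0 //.
- rewrite size_map; have sp := perm_size pp; rewrite -sp in sL.
  exact: ltnW.
- exact: (wf_weld_perm pp).
- by rewrite occ_ren; move: mL; rewrite -(occ_perm x pp) /occ /= -ap (negPf nax).
Qed.

(** By the pigeonhole principle, some label occurs on more than [2m] legs. *)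
Lemma wick_vanish D : wf D -> (2 * m * #|X| < size (legs D))%N -> wick ev delta D = 0.
Proof.
case: D => vs L c wfD /= mL.
have [x mx] : exists x, (2 * m < occ x L)%N.
  apply/existsP; apply: contraLR mL => /existsPn h.
  rewrite -leqNgt -sum_occ mulnC -sum_nat_const; apply: leq_sum => x _.
  by rewrite leqNgt h.
exact: wick_occ_vanish mx.
Qed.

(** The number of ways to build a given matching, as pairs of legs with equal
    labels, from struts with both ends labelled as listed in [s]. *)
Fixpoint repetitions (s : seq X) : nat :=
  if s is x :: s' then (2 * (count_mem x s').+1 * repetitions s')%N else 1%N.

(** The first strut, with ends labelled [x], joins two legs labelled [x]; the
    sum over the first of them multiplies the number of matchings by the number
    of legs labelled [x], which is twice the number of struts of that kind. *)
Lemma contract_diag s D :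
  contract ev (map (fun x => (x, x)) s) D =
  if [forall x, occ x (legs D) == (count_mem x s).*2]
  then (repetitions s)%:R *: wick ev delta D else 0.
Proof.
elim: s D => [|x s IH] [vs L c] /=.
  case: ifP => [/forallP h|/forallP h].
    case: L h => [|a L] h; first by rewrite scale1r.
    by have := h a.1; rewrite /occ /= eqxx.
  by case: L h => // h; case: h.
have occL p q y : p \in picks L -> q \in picks p.2 -> p.1.1 == x -> q.1.1 == x ->
    (occ y q.2 == (count_mem y s).*2) = (occ y L == ((x == y) + count_mem y s).*2).
  move=> pL qL /eqP px /eqP qx.
  rewrite -(occ_perm y (perm_picks pL)) /occ /= px -/(occ y p.2).
  rewrite -(occ_perm y (perm_picks qL)) /occ /= qx.
  by rewrite doubleD addnA addnn eqn_add2l.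
transitivity (if [forall y, occ y L == ((x == y) + count_mem y s).*2] then
   \sum_(p <- picks L | p.1.1 == x) \sum_(q <- picks p.2 | q.1.1 == x)
     (repetitions s)%:R *: wick ev delta (weld p.1.2 q.1.2 (Diagram vs q.2 c)) else 0).
  case: ifP => h; last first.
    rewrite big_seq_cond big1 // => p /andP[pL px]; rewrite big_seq_cond big1 // => q /andP[qL qx].
    rewrite IH /=; under eq_forallb => y do rewrite occ_ren (occL p q) //.
    by rewrite h.
  rewrite big_seq_cond [RHS]big_seq_cond; apply: eq_bigr => p /andP[pL px].
  rewrite big_seq_cond [RHS]big_seq_cond; apply: eq_bigr => q /andP[qL qx].
  rewrite IH /=; under eq_forallb => y do rewrite occ_ren (occL p q) //.
  by rewrite h.
case: ifP => // /forallP /(_ x); rewrite eqxx => /eqP hx.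
transitivity (\sum_(p <- picks L | p.1.1 == x)
    (repetitions s)%:R *: wick ev delta (Diagram vs L c)).
  rewrite big_seq_cond [RHS]big_seq_cond; apply: eq_bigr => p /andP[pL /eqP px].
  rewrite -(wick_perm ev_iso delta_sym vs c (perm_picks pL)) wick_cons.
  rewrite -scaler_sumr; congr (_ *: _); rewrite big_mkcond /=; apply: eq_bigr => q _.
  by rewrite /delta px eq_sym; case: eqP; rewrite ?scale1r ?scale0r.
rewrite big_const_seq iter_addr_0.
have -> : count (fun p : (X * nat) * seq (X * nat) => p.1.1 == x) (picks L) = occ x L.
  by rewrite /occ -[in RHS](map_picks1 L) count_map.
rewrite hx -scaler_nat scalerA -natrM; congr (_%:R *: _).
by rewrite add1n -mul2n mulnC.
Qed.

(** The labels of the struts in the product over [x] of the [m]-th powers of the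
    strut with both ends labelled [x]. *)
Definition top_word : seq X := flatten [seq nseq m x | x <- enum X].

Lemma count_top_word x : count_mem x top_word = m.
Proof.
rewrite /top_word count_flatten -map_comp sumnE big_map big_enum /=.
rewrite (bigD1 x) //= count_nseq /= eqxx mul1n big1 ?addn0 // => y /negPf yx.
by rewrite count_nseq /= yx.
Qed.

Lemma repetitions_top_word : repetitions top_word = ((2 ^ m * m`!) ^ #|X|)%N.
Proof.
rewrite /top_word cardE; elim: (enum X) (enum_uniq X) => [|x s IH] //= /andP[xs /IH].
have: count_mem x (flatten [seq nseq m x0 | x0 <- s]) = 0%N.
  apply/eqP; rewrite -leqn0 leqNgt -has_count has_pred1.
  by apply: contra xs => /flattenP[_ /mapP[y ys ->]] /nseqP[->].
move: (flatten _) => t xt; rewrite expnS => <-.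
elim: (m) => [|k {}IH] /=; first by rewrite expn0 fact0 !mul1n.
rewrite IH count_cat count_nseq /= eqxx mul1n xt addn0 expnS factS; lia.
Qed.

(** If [D] has [2m |X|] legs but not [2m] for each label, then some label
    occurs more often and the right hand side vanishes by P_{m+1}, as does the
    left hand side for want of matching labels. *)
Lemma contract_top D : wf D ->
  contract ev (map (fun x => (x, x)) top_word) D =
  if size (legs D) == (2 * m * #|X|)%N
  then ((2 ^ m * m`!) ^ #|X|)%:R *: wick ev delta D else 0.
Proof.
move=> wfD; rewrite contract_diag repetitions_top_word.
under eq_forallb => x do rewrite count_top_word -mul2n.
case: ifP => [/forallP h|/forallP h].
  rewrite -sum_occ ifT // mulnC -sum_nat_const; apply/eqP; apply: eq_bigr => x _.
  exact/eqP.
case: eqP => // sD; case: D wfD h sD => vs L c wfD h /= sD.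
have [[x mx]|no] := pselect (exists x, (2 * m < occ x L)%N).
  by rewrite (wick_occ_vanish wfD mx) scaler0.
case: h => x; rewrite eqn_leq andbC leqNgt; apply/andP; split; last first.
  by rewrite leqNgt; apply/negP => mx; apply: no; exists x.
apply/negP => mx; move: sD; rewrite -sum_occ mulnC -sum_nat_const; apply/eqP.
rewrite neq_ltn; apply/orP; left; rewrite (bigD1 x) //= [ltnRHS](bigD1 x) //=.
rewrite -addSn leq_add //; apply: leq_sum => y _; rewrite leqNgt.
by apply/negP => my; apply: no; exists y.
Qed.
End Vanishing.

(** * Adding struts to a diagram *)

Lemma diagram_iso_perm (X : eqType) vs (L M : seq (X * nat)) c : perm_eq L M ->
  diagram_iso (Diagram vs L c) (Diagram vs M c).
Proof.
move=> LM; exists id; split=> //=; last by rewrite map_ren_leg_id perm_sym.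
by exists vs; [rewrite map_ren_vertex_id | apply: all2_rotation_refl].
Qed.

Definition fresh X (D : diagram X) : nat := (\max_(e <- ends D) e).+1.

Lemma fresh_ends X (D : diagram X) : fresh D \notin ends D.
Proof.
apply/negP => h; have := @leq_bigmax_seq _ _ xpredT id _ h erefl.
by rewrite /fresh ltnn.
Qed.

Definition add_strut X (x y : X) n (D : diagram X) : diagram X :=
  Diagram (verts D) ((x, n) :: (y, n) :: legs D) (circles D).

Lemma ends_add_strut X (x y : X) n D :
  perm_eq (ends (add_strut x y n D)) (n :: n :: ends D).
Proof. by rewrite /ends /= (perm_catCA _ [:: n; n]). Qed.

Lemma wf_add_strut (X : eqType) (x y : X) n D :
  n \notin ends D -> wf D -> wf (add_strut x y n D).
Proof.
move=> nD; rewrite !wfE (perm_twice (ends_add_strut x y n D)) => /twiceP h.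
apply/twiceP => e; rewrite !inE /=; have [-> _|ne /=] := eqVneq e n.
  by rewrite ?eqxx (count_memPn nD).
by move=> /h; rewrite !add0n.
Qed.

Lemma iso_add_strut (X : eqType) (x y : X) n n' D D' :
  diagram_iso D D' -> n \notin ends D -> n' \notin ends D' ->
  diagram_iso (add_strut x y n D) (add_strut x y n' D').
Proof.
move=> [phi [inj [vs pvs rvs] pL ec]] nD nD'.
pose psi g := if g == n then n' else phi g.
have psiE g : g \in ends D -> psi g = phi g.
  by rewrite /psi; case: eqP => // -> gD; rewrite gD in nD.
have phin' g : g \in ends D -> phi g != n'.
  move=> gD; apply: contraNneq nD' => <-.
  by rewrite (perm_mem (iso_ends pvs rvs pL)) map_f.
have psin : psi n = n' by rewrite /psi eqxx.
exists psi; split=> //=.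
- move=> g h; rewrite !(perm_mem (ends_add_strut x y n D)) !inE.
  case/or3P=> [/eqP->|/eqP->|gD]; case/or3P=> [/eqP->|/eqP->|hD] //;
    rewrite ?psin ?psiE // ?(psiE g) // => e.
  + by have := phin' h hD; rewrite e eqxx.
  + by have := phin' h hD; rewrite e eqxx.
  + by have := phin' g gD; rewrite -e eqxx.
  + by have := phin' g gD; rewrite -e eqxx.
  + exact: inj.
- exists vs => //; rewrite (@eq_ren_vertex psi phi) // => g gv.
  by apply: psiE; rewrite mem_cat gv.
- rewrite {1 2}/ren_leg /= psin !perm_cons (@eq_ren_leg _ psi phi) // => g gv.
  by apply: psiE; rewrite mem_cat gv orbT.
Qed.

Lemma fuse_notin e f vs X (L : seq (X * nat)) c : f \notin ends (Diagram vs L c) ->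
  map (ren_vertex (fuse e f)) vs = vs /\ map (ren_leg (fuse e f)) L = L.
Proof.
rewrite mem_cat negb_or /= => /andP[fv fL]; split.
  rewrite (@eq_ren_vertex _ id) ?map_ren_vertex_id // => g gv.
  by rewrite /fuse; case: eqP => // gf; rewrite -gf gv in fv.
rewrite (@eq_ren_leg _ _ id) ?map_ren_leg_id // => g gv.
by rewrite /fuse; case: eqP => // gf; rewrite -gf gv in fL.
Qed.

(** * Integrals against a power of the quadratic form *)

Section Gauss.
Variables (K : fieldType) (V : lmodType K) (ev : diagram void -> V).
Hypothesis ev_iso : forall D D' : diagram void, diagram_iso D D' -> ev D = ev D'.
Variables (X : finType) (l : X -> X -> K).
Hypothesis l_sym : forall x y, l x y = l y x.
Implicit Types (D : diagram X) (L : seq (X * nat)).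
Local Notation delta := (@delta K X).

(** The sum of the matchings of [D] multiplied by the [k]-th power of
    [\sum_(x, y) l x y] times the strut with ends [x] and [y].  The factors
    [1/2] and [1/k!] of the exponential are left out, which keeps the recursions
    free of denominators. *)
Fixpoint gauss k D : V :=
  if k is k'.+1 then
    \sum_x \sum_y l x y *: gauss k' (add_strut x y (fresh D) D)
  else wick ev delta D.

Lemma gauss_iso k D D' : diagram_iso D D' -> gauss k D = gauss k D'.
Proof.
elim: k D D' => [|k IH] D D' iso /=; first exact: (wick_iso ev_iso (@delta_sym K X)).
apply: eq_bigr => x _; apply: eq_bigr => y _; congr (_ *: _); apply: IH.
by apply: iso_add_strut => //; apply: fresh_ends.
Qed.

Lemma gauss_perm k vs L M c : perm_eq L M ->
  gauss k (Diagram vs L c) = gauss k (Diagram vs M c).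
Proof. by move=> LM; apply/gauss_iso/diagram_iso_perm. Qed.

Lemma gaussS k D n : n \notin ends D ->
  gauss k.+1 D = \sum_x \sum_y l x y *: gauss k (add_strut x y n D).
Proof.
move=> nD; apply: eq_bigr => x _; apply: eq_bigr => y _; congr (_ *: _); apply: gauss_iso.
apply: iso_add_strut => //; last exact: fresh_ends.
by case: (D) => *; apply: diagram_iso_perm.
Qed.

Lemma delta_sum (F : X -> V) x : \sum_y delta x y *: F y = F x.
Proof.
rewrite (bigD1 x) //= /delta eqxx scale1r big1 ?addr0 // => y.
by rewrite eq_sym => /negPf ->; rewrite scale0r.
Qed.

(** Expansion along the leg [a]: its partner is another leg of the diagram, or one
    of the [2k] ends of the struts; in the latter case the leg is moved to the
    other end of this strut. *)
Lemma gauss_cons k vs a L c :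
  gauss k (Diagram vs (a :: L) c) =
  \sum_(p <- picks L) delta a.1 p.1.1 *: gauss k (weld a.2 p.1.2 (Diagram vs p.2 c)) +
  (2 * k)%:R *: \sum_y l a.1 y *: gauss k.-1 (Diagram vs ((y, a.2) :: L) c).
Proof.
elim: k vs a L c => [|k IH] vs a L c; first by rewrite /= wick_cons muln0 scale0r addr0.
pose D := Diagram vs (a :: L) c; pose n := fresh D.
have nD : n \notin ends D := fresh_ends D.
have nDa b : n \notin ends (Diagram vs ((b, a.2) :: L) c) by [].
have na : n != a.2.
  by apply: contraNneq nD => ->; rewrite mem_cat mem_head orbT.
have nL : n \notin ends (Diagram vs L c).
  by apply: contra nD; rewrite !mem_cat inE => /orP[->|/= ->]; rewrite ?orbT.
have wn b : weld a.2 n (Diagram vs ((b, n) :: L) c) = Diagram vs ((b, a.2) :: L) c.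
  have [ev' eL] := fuse_notin a.2 nL.
  by rewrite /weld /= ev' eL /ren_leg /= /fuse eqxx [a.2 == n]eq_sym (negPf na) addn0.
pose T (p : (X * nat) * seq (X * nat)) := gauss k.+1 (weld a.2 p.1.2 (Diagram vs p.2 c)).
have TE (p : (X * nat) * seq (X * nat)) : p \in picks L -> T p = \sum_x \sum_y
    l x y *: gauss k (weld a.2 p.1.2 (Diagram vs ((x, n) :: (y, n) :: p.2) c)).
  move=> pL.
  have sub g : g \in p.1.2 :: ends (Diagram vs p.2 c) -> g \in ends (Diagram vs L c).
    rewrite inE !mem_cat /= -(perm_mem (perm_map snd (perm_picks pL))) /= inE.
    by case/or3P => ->; rewrite ?orbT.
  have np : n != p.1.2.
    by apply: contraNneq nL => ->; rewrite sub ?mem_head.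
  rewrite /T (@gaussS _ _ n).
    apply: eq_bigr => x _; apply: eq_bigr => y _; congr (_ *: gauss _ _).
    rewrite /weld /add_strut /=. have np' : fuse a.2 p.1.2 n = n by rewrite /fuse (negPf np).
    by rewrite [ren_leg _ (x, n)]/ren_leg [ren_leg _ (y, n)]/ren_leg /= np'.
  rewrite (ends_relabel _ _ _ _ c); apply/mapP => -[g gE]; rewrite /fuse.
  case: eqP => _ ng; first by rewrite ng eqxx in na.
  by move: nL; rewrite sub // inE ng gE orbT.
(* The last strut has ends [(x, n)] and [(y, n)]; the four sums below are over
   the partners [(x, n)], [(y, n)], the legs in [L], and the ends of the other struts. *)
rewrite (gaussS _ nD) /= [RHS]addrC.
transitivity (
    (\sum_x \sum_y delta a.1 x *: (l x y *: gauss k (Diagram vs ((y, a.2) :: L) c)) +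
     \sum_x \sum_y delta a.1 y *: (l x y *: gauss k (Diagram vs ((x, a.2) :: L) c))) +
    (\sum_x \sum_y \sum_(p <- picks L) l x y *: (delta a.1 p.1.1 *:
      gauss k (weld a.2 p.1.2 (Diagram vs ((x, n) :: (y, n) :: p.2) c))) +
    \sum_x \sum_y (2 * k)%:R *: \sum_z l a.1 z *: (l x y *:
      gauss k.-1 (Diagram vs ((x, n) :: (y, n) :: (z, a.2) :: L) c)))).
  rewrite -!big_split /=; apply: eq_bigr => x _; rewrite -!big_split /=.
  apply: eq_bigr => y _; rewrite /add_strut /=.
  rewrite (gauss_perm _ _ _ (_ : perm_eq _ (a :: (x, n) :: (y, n) :: L))); last first.
    by rewrite (perm_catCA [:: (x, n); (y, n)] [:: a]).
  rewrite (IH vs a ((x, n) :: (y, n) :: L)) /= !big_cons !big_map /= !wn !scalerDr !scalerA !addrA.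
  congr (_ + _ + _ + _); rewrite ?[l x y * _]mulrC //; last first.
    rewrite -scalerA scaler_sumr; congr (_ *: _).
    apply: eq_bigr => z _; rewrite !scalerA mulrC; congr (_ *: _).
    by apply: gauss_perm; rewrite (perm_catCA [:: (z, a.2)] [:: (x, n); (y, n)]).
  by rewrite scaler_sumr.
have -> : \sum_x \sum_y delta a.1 x *: (l x y *: gauss k (Diagram vs ((y, a.2) :: L) c))
   = \sum_y l a.1 y *: gauss k (Diagram vs ((y, a.2) :: L) c).
  by under eq_bigr => x _ do rewrite -scaler_sumr; rewrite delta_sum.
have -> : \sum_x \sum_y delta a.1 y *: (l x y *: gauss k (Diagram vs ((x, a.2) :: L) c))
   = \sum_y l a.1 y *: gauss k (Diagram vs ((y, a.2) :: L) c).
  rewrite exchange_big /=; under eq_bigr => y _ do rewrite -scaler_sumr.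
  by rewrite delta_sum; apply: eq_bigr => x _; rewrite l_sym.
have -> : \sum_x \sum_y \sum_(p <- picks L) l x y *: (delta a.1 p.1.1 *:
      gauss k (weld a.2 p.1.2 (Diagram vs ((x, n) :: (y, n) :: p.2) c))) =
   \sum_(p <- picks L) delta a.1 p.1.1 *: T p.
  under eq_bigr => x _ do rewrite exchange_big /=.
  rewrite exchange_big /=; apply: eq_big_seq => p pL; rewrite TE // scaler_sumr.
  apply: eq_bigr => x _; rewrite scaler_sumr; apply: eq_bigr => y _.
  by rewrite !scalerA mulrC.
have -> : (2 * k.+1)%:R = 1 + 1 + (2 * k)%:R :> K by rewrite mulnS natrD.
rewrite !scalerDl !scale1r [X in _ + _ + X = _]addrC addrA; congr (_ + _ + _ + _).
case: k {IH T TE} => [|k] /=.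
  rewrite muln0 scale0r big1 // => x _; rewrite big1 // => y _.
  by rewrite scale0r.
under eq_bigr => x _ do rewrite -scaler_sumr.
rewrite -scaler_sumr; congr (_ *: _).
transitivity (\sum_z l a.1 z *: gauss k.+1 (Diagram vs ((z, a.2) :: L) c)) => //.
under [RHS]eq_bigr => z _ do rewrite (gaussS _ (nDa z)) scaler_sumr.
rewrite [RHS]exchange_big /=; apply: eq_bigr => x _.
under [RHS]eq_bigr => z _ do rewrite scaler_sumr.
rewrite [RHS]exchange_big /=; apply: eq_bigr => y _; exact: eq_bigr.
Qed.
End Gauss.

(** * Newton's identities *)

Section Newton.
Variable K : fieldType.

Lemma deriv_prod (I : finType) (P : pred I) (F : I -> {poly K}) :
  (\prod_(i | P i) F i)^`() =
  \sum_(i | P i) (F i)^`() * \prod_(j | P j && (j != i)) F j.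
Proof.
have [n] := ubnP #|P|; elim: n P => [|n IH] P; first by [].
move=> sP; have [i Pi|P0] := pickP P; last by rewrite !big_pred0 // derivC.
rewrite (bigD1 i) // [RHS](bigD1 i) //= derivM IH; last first.
  have iP : i \in P by [].
  rewrite (cardD1 i) iP add1n ltnS in sP; apply: leq_trans sP; rewrite ltnS.
  by apply: subset_leq_card; apply/fintype.subsetP => j; rewrite !inE andbC.
congr (_ + _); rewrite mulr_sumr; apply: eq_bigr => j /andP[Pj ji].
rewrite [in RHS](bigD1 i) /= ?Pi 1?eq_sym //= mulrCA; congr (_ * (_ * _)).
by apply: eq_bigl => k; rewrite -!andbA; congr (_ && _); rewrite andbC.
Qed.

Lemma polyC_sign (b : bool) : (-1) ^+ b = ((-1) ^+ b)%:P :> {poly K}.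
Proof. by case: b; rewrite ?expr0 ?expr1 // polyCN. Qed.

(** Jacobi's formula: by multilinearity the derivative of a determinant is the
    sum of the determinants with one row differentiated. *)
Lemma deriv_det n (M : 'M[{poly K}]_n) :
  (\det M)^`() = \tr (map_mx (@deriv K) M *m \adj M).
Proof.
pose R i : 'M[{poly K}]_n := \matrix_(a, b) if a == i then (M a b)^`() else M a b.
transitivity (\sum_i \det (R i)).
  rewrite /determinant raddf_sum exchange_big /=; apply: eq_bigr => s _.
  rewrite polyC_sign /= derivM derivC mul0r add0r deriv_prod mulr_sumr.
  apply: eq_bigr => i _; congr (_ * _).
  rewrite [RHS](bigD1 i) //= mxE eqxx; congr (_ * _); apply: eq_bigr => j ji.
  by rewrite mxE (negPf ji).
rewrite /mxtrace; apply: eq_bigr => i _; rewrite (expand_det_row _ i) mxE.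
apply: eq_bigr => j _; rewrite !mxE eqxx; congr (_ * _).
rewrite /cofactor; congr (_ * \det _); apply/matrixP => a b.
by rewrite !mxE eq_sym (negPf (neq_lift _ _)).
Qed.

(** The coefficient in the highest degree allowed by the bounds is
    multiplicative, even if it happens to be zero. *)
Lemma coefM_top (p q : {poly K}) a b : (size p <= a.+1)%N -> (size q <= b.+1)%N ->
  (size (p * q)%R <= (a + b).+1)%N /\ (p * q)`_(a + b) = p`_a * q`_b.
Proof.
move=> sp sq; split.
  apply: leq_trans (size_polyMleq p q) _; lia.
rewrite coefM.
rewrite (bigD1 (inord a)) //= inordK ?leq_addr // ?ltnS ?leq_addr // addKn.
rewrite big1 ?addr0 // => i ia.
have {}ia : (i : nat) != a.
  apply: contraNneq ia => ia; apply/eqP/val_inj.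
  by rewrite /= inordK // ltnS leq_addr.
have [ai|ai] := ltnP a i; first by rewrite (nth_default _ (leq_trans sp ai)) mul0r.
rewrite [q`__]nth_default ?mulr0 //; apply: leq_trans sq _; lia.
Qed.

Lemma coef_prod_top (I : Type) (r : seq I) (F : I -> {poly K}) :
  (forall i, size (F i) <= 2)%N ->
  (size (\prod_(i <- r) F i)%R <= (size r).+1)%N /\
  (\prod_(i <- r) F i)`_(size r) = \prod_(i <- r) (F i)`_1.
Proof.
move=> s2; elim: r => [|i r [IHs IHc]].
  by rewrite !big_nil size_poly1 coef1.
rewrite !big_cons /= -IHc; exact: (coefM_top (s2 i) IHs).
Qed.

Lemma coef_exp_top (p : {poly K}) a n : (size p <= a.+1)%N ->
  (size (p ^+ n)%R <= (n * a).+1)%N /\ (p ^+ n)`_(n * a) = p`_a ^+ n.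
Proof.
move=> sp; elim: n => [|n [IHs IHc]]; first by rewrite expr0 size_poly1 coef1.
by rewrite !exprS mulSn -IHc; exact: coefM_top.
Qed.

Variables (n m : nat) (A : 'M[K]_n).

(** The coefficients of [det (1 - t A)] are the elementary symmetric functions of
    the eigenvalues of [A], up to signs. *)
Definition charM : 'M[{poly K}]_n := 1%:M - 'X *: map_mx polyC A.
Definition rev_char : {poly K} := \det charM.

Lemma rev_char_top : (size rev_char <= n.+1)%N /\ rev_char`_n = (-1) ^+ n * \det A.
Proof.
have s2 i j : (size (charM i j) <= 2)%N.
  rewrite !mxE; apply: leq_trans (size_polyD _ _) _; rewrite size_polyN geq_max.
  apply/andP; split; first by case: eqP; rewrite /= ?size_poly0 // size_poly1.
  apply: leq_trans (size_polyMleq _ _) _; rewrite size_polyX /=.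
  exact: size_polyC_leq1.
have c1 i j : (charM i j)`_1 = - A i j.
  by rewrite !mxE coefB coefXM coefC -polyCMn coefC /= sub0r.
have prodS (s : 'S_n) := coef_prod_top (index_enum 'I_n) (fun i => s2 i (s i)).
have sI : size (index_enum 'I_n) = n by rewrite [index_enum _]unlock -enumT size_enum_ord.
rewrite sI in prodS.
split.
  rewrite /rev_char /determinant; apply: leq_trans (size_sum _ _ _) _.
  apply/bigmax_leqP => s _; rewrite -signr_odd; case: odd_perm.
    by rewrite expr1 mulN1r size_polyN; have [] := prodS s.
  by rewrite expr0 mul1r; have [] := prodS s.
rewrite /rev_char /determinant coef_sum mulr_sumr; apply: eq_bigr => s _.
rewrite polyC_sign coefCM (prodS s).2 mulrCA; congr (_ * _).
under eq_bigr => i _ do rewrite c1 -mulN1r.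
by rewrite big_split /= prodr_const card_ord.
Qed.

Lemma rev_char0 : rev_char`_0 = 1.
Proof.
rewrite -horner_coef0 /rev_char.
have -> : (\det charM).[0] = \det (map_mx (horner_eval 0) charM) by rewrite det_map_mx.
rewrite (_ : map_mx _ _ = 1%:M) ?det1 //; apply/matrixP => i j.
rewrite !mxE /horner_eval hornerD hornerN hornerM hornerX mul0r subr0.
by case: (i == j); rewrite /= !hornerE.
Qed.

(** The coefficients of the power series [E(t) (1 - t A)^{-1}], where [e] lists
    the coefficients of [E]. *)
Fixpoint newton_mx (e : nat -> K) k : 'M[K]_n :=
  if k is k'.+1 then (e k)%:M + A *m newton_mx e k' else (e 0%N)%:M.

(** For [m > 0] and [E = det (1 - t A) ^ m], the matrix [E (1 - t A)^{-1}] is the product of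
    [det (1 - t A) ^ (m - 1)] and the adjugate of [1 - t A].  On the other hand,
    the derivative of [E] is [- m det (1 - t A) ^ (m - 1)] times the trace of [A]
    times this adjugate, by Jacobi's formula. *)
Lemma newton (e := fun k => (rev_char ^+ m)`_k) k :
  k.+1%:R * e k.+1 = - m%:R * \tr (A *m newton_mx e k).
Proof.
rewrite /e; case: m => [|m']; first by rewrite expr0 coef1 mulr0 oppr0 mul0r.
set f := fun k => _.
pose B := rev_char ^+ m' *: \adj charM.
have BE : charM *m B = (rev_char ^+ m'.+1)%:M.
  by rewrite -scalemxAr mul_mx_adj scale_scalar_mx -exprSr.
have Brec j : map_mx (coefp j) B =
    (f j)%:M + map_mx (coefp j) (('X *: map_mx polyC A) *m B).
  have := congr1 (map_mx (coefp j)) BE; rewrite mulmxBl mul1mx map_mxB.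
  have -> : map_mx (coefp j) (rev_char ^+ m'.+1)%:M = (f j)%:M :> 'M_n.
    apply/matrixP => a b; rewrite !mxE /f /=; case: (a == b) => //=.
    by rewrite coef0.
  by move/(canRL (subrK _)) => ->.
have Bk j : map_mx (coefp j) B = newton_mx f j.
  elim: j => [|j IH]; rewrite Brec /=.
    rewrite [X in _ + X](_ : _ = 0) ?addr0 //.
    by apply/matrixP => a b; rewrite -scalemxAl !mxE /= coefXM.
  congr (_ + _); rewrite -IH; apply/matrixP => a b.
  rewrite -scalemxAl !mxE /= coefXM /= coef_sum.
  by apply: eq_bigr => i _; rewrite !mxE coefCM.
have e1 : (rev_char ^+ m'.+1)^`()`_k = k.+1%:R * f k.+1.
  by rewrite coef_deriv mulr_natl.
rewrite -e1 deriv_exp /= deriv_det.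
have -> : map_mx (@deriv K) charM = - map_mx polyC A.
  apply/matrixP => a b; rewrite !mxE derivB derivM derivX mul1r derivC mulr0 addr0.
  by case: (a == b); rewrite /= ?derivC ?sub0r // -polyC1 derivC sub0r.
rewrite -Bk coefMn mulNmx linearN /= [- \tr _ * _]mulNr coefN mulNrn mulNr mulr_natl.
congr (- (_ *+ _)); rewrite mulrC -mxtraceZ scalemxAr /mxtrace coef_sum.
apply: eq_bigr => i _; rewrite !mxE coef_sum; apply: eq_bigr => j _.
by rewrite !mxE coefCM.
Qed.

Lemma newton_top (e := fun k => (rev_char ^+ m)`_k) :
  e 0%N = 1 /\ e (m * n)%N = (-1) ^+ (m * n) * \det A ^+ m.
Proof.
rewrite /e; split.
  by rewrite -horner_coef0 horner_exp horner_coef0 rev_char0 expr1n.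
have [s top] := rev_char_top; rewrite (coef_exp_top m s).2 top exprMn.
by rewrite -exprM mulnC.
Qed.
End Newton.

(** * The Gaussian integral as a sum over matchings *)

Section GaussIntegral.
Variables (K : fieldType) (V : lmodType K) (ev : diagram void -> V) (m : nat).
Hypothesis K_char0 : forall n, n.+1%:R != 0 :> K.
Hypothesis ev_iso : forall D D' : diagram void, diagram_iso D D' -> ev D = ev D'.
Hypothesis ev_O : forall vs c,
  ev (Diagram vs [::] c.+1) = (- (2 * m)%:R) *: ev (Diagram vs [::] c).
Hypothesis ev_P : forall D : diagram unit, wf D -> size (legs D) = (2 * m + 2)%N ->
  \sum_(ps <- matchings (map snd (legs D))) ev (join_legs ps (verts D) (circles D)) = 0.
Variables (X : finType) (l : X -> X -> K).
Hypothesis l_sym : forall x y, l x y = l y x.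
Implicit Types (D : diagram X) (L : seq (X * nat)).
Local Notation delta := (@delta K X).
Local Notation gauss := (gauss ev l).

Lemma gauss_vanish k D : wf D -> (2 * m * #|X| < size (legs D) + 2 * k)%N -> gauss k D = 0.
Proof.
elim: k D => [|k IH] D wfD mD /=.
  by rewrite muln0 addn0 in mD; apply: wick_vanish wfD mD.
rewrite big1 // => x _; rewrite big1 // => y _; rewrite IH ?scaler0 //.
  exact: wf_add_strut (fresh_ends D) wfD.
by move: mD; rewrite /= mulnS; lia.
Qed.

Lemma wick_circle w vs L c :
  wick ev w (Diagram vs L c.+1) = (- (2 * m)%:R) *: wick ev w (Diagram vs L c).
Proof.
elim: {L}(size L) {-2}L vs c (leqnn (size L)) => [|n IH] [|a L] vs c // sL;
  try exact: ev_O.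
rewrite !wick_cons scaler_sumr; apply: eq_big_seq => p pL.
rewrite /weld /= addSn IH ?scalerA 1?mulrC //.
by rewrite size_map (leq_size_picks pL) // ltnW.
Qed.

Lemma gauss_circle k vs L c :
  gauss k (Diagram vs L c.+1) = (- (2 * m)%:R) *: gauss k (Diagram vs L c).
Proof.
elim: k vs L c => [|k IH] vs L c /=; first exact: wick_circle.
rewrite scaler_sumr; apply: eq_bigr => x _; rewrite scaler_sumr; apply: eq_bigr => y _.
by rewrite /add_strut /= IH !scalerA mulrC.
Qed.

Let A := Lambda l.
Let e k := (rev_char A ^+ m)`_k.
Let N k x y := newton_mx A e k (enum_rank x) (enum_rank y).

Lemma sum_enum_rank (U : nmodType) (F : 'I_#|X| -> U) : \sum_i F i = \sum_x F (enum_rank x).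
Proof. by rewrite (reindex (@enum_rank X)) //; apply/onW_bij/enum_rank_bij. Qed.

Lemma LambdaE x y : A (enum_rank x) (enum_rank y) = l x y.
Proof. by rewrite mxE !enum_rankK. Qed.

Lemma N0 x y : N 0 x y = e 0%N * delta x y.
Proof. by rewrite /N /= mxE (inj_eq enum_rank_inj) mulr_natr. Qed.

Lemma NS k x y : N k.+1 x y = e k.+1 * delta x y + \sum_z l x z * N k z y.
Proof.
rewrite /N /= !mxE (inj_eq enum_rank_inj) mulr_natr; congr (_ + _).
by rewrite sum_enum_rank; apply: eq_bigr => z _; rewrite LambdaE.
Qed.

Lemma newton_sum k : k.+1%:R * e k.+1 = - m%:R * \sum_x \sum_y l x y * N k x y.
Proof.
rewrite newton /mxtrace sum_enum_rank; congr (_ * _).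
rewrite [RHS]exchange_big; apply: eq_bigr => x _; rewrite mxE sum_enum_rank.
by apply: eq_bigr => y _; rewrite LambdaE l_sym.
Qed.

(** [a_k D] and [b_k x y D], for the integrals of [D] and of [D] with an additional
    strut, satisfy [b_k = -2m a_k 1 + 2k l b_(k-1)] as matrices indexed by [X], by
    expansion along one end of the strut, which forms a circle when it meets the other end.  Moreover
    [a_(k+1)] is the trace of [l b_k].  Up to the factors [2^k k!], this is the
    recursion in [newton] and [newton_mx]. *)
Lemma gauss_closed k vs c (D := Diagram vs [::] c : diagram X) :
  gauss k D = ((2 ^ k * k`!)%:R * e k) *: ev (Diagram vs [::] c) /\
  forall n x y, n \notin ends D ->
    gauss k (add_strut x y n D) =
    (- (2 * m)%:R * (2 ^ k * k`!)%:R * N k x y) *: ev (Diagram vs [::] c).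
Proof.
have strut_loop n x y k' : n \notin ends D ->
    gauss k' (add_strut x y n D) = (- (2 * m)%:R * delta x y) *: gauss k' D +
      (2 * k')%:R *: \sum_z l x z *: gauss k'.-1 (add_strut z y n D).
  move=> nD; rewrite /add_strut /D /= gauss_cons //= big_seq1; congr (_ + _).
  have [ev' _] := fuse_notin n nD.
  by rewrite /weld /= ev' eqxx addn1 gauss_circle scalerA mulrC.
elim: k => [|k [IH1 IH2]].
  have [e0 _] := newton_top m A.
  have H1 : gauss 0 D = ((2 ^ 0 * 0`!)%:R * e 0) *: ev (Diagram vs [::] c).
    by rewrite /= /e e0 mulr1 scale1r.
  split=> // n x y nD; rewrite strut_loop // muln0 scale0r addr0 H1 scalerA N0.
  by congr (_ *: _); ring.
have H1 : gauss k.+1 D = ((2 ^ k.+1 * k.+1`!)%:R * e k.+1) *: ev (Diagram vs [::] c).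
  rewrite (gaussS ev_iso l _ (fresh_ends D)).
  transitivity (\sum_x \sum_y (l x y * (- (2 * m)%:R * (2 ^ k * k`!)%:R * N k x y)) *:
      ev (Diagram vs [::] c)).
    apply: eq_bigr => x _; apply: eq_bigr => y _.
    by rewrite IH2 ?fresh_ends // scalerA.
  under eq_bigr => x _ do rewrite -scaler_suml.
  rewrite -scaler_suml; congr (_ *: _).
  rewrite expnS factS.
  have -> : (2 * 2 ^ k * (k.+1 * k`!))%N = (2 * (2 ^ k * k`!) * k.+1)%N by lia.
  rewrite [in RHS]natrM -mulrA newton_sum !natrM.
  under eq_bigr => x _ do under eq_bigr => y _ do rewrite mulrCA.
  under eq_bigr => x _ do rewrite -mulr_sumr.
  rewrite -mulr_sumr; ring.
split=> // n x y nD; rewrite strut_loop // H1 /= NS.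
under eq_bigr => z _ do rewrite IH2 // scalerA.
rewrite -scaler_suml !scalerA -scalerDl; congr (_ *: _).
rewrite mulrDr mulr_sumr; congr (_ + _); first by ring.
rewrite !mulr_sumr; apply: eq_bigr => z _.
rewrite expnS factS !natrM; ring.
Qed.

Variable linv : X -> X -> K.
Hypothesis linvK : forall x y, \sum_z linv x z * l z y = delta x y.

Let M := (m * #|X|)%N.
Let cf k : K := (2 ^ k * k`!)%:R.

Lemma cf_neq0 k : cf k != 0.
Proof.
rewrite /cf; have : (0 < 2 ^ k * k`!)%N by rewrite muln_gt0 expn_gt0 fact_gt0.
by case: (_ * _)%N => // n _; apply: K_char0.
Qed.

(** With [2j] legs on [D], only the term of degree [M - j] of the exponential
    leads to the number [2M] of legs that the integral requires; the
    factor [cf k] restores the coefficient [1/k!] and the halves in the quadratic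
    form.  If [j] exceeds [M] there is no such term. *)
Definition gauss_int D : V :=
  let j := (size (legs D))./2 in
  if (j <= M)%N then (cf (M - j))^-1 *: gauss (M - j) D else 0.

(** Integration by parts: the integral of a diagram with too many legs vanishes,
    and its expansion along the leg [(x, a.2)] consists of the two sides. *)
Lemma gauss_int_parts x vs a L c :
  wf (Diagram vs (a :: L) c) -> odd (size L) ->
  \sum_(p <- picks L) delta x p.1.1 *: gauss_int (weld a.2 p.1.2 (Diagram vs p.2 c)) =
  - \sum_y l x y *: gauss_int (Diagram vs ((y, a.2) :: L) c).
Proof.
move=> wfL oL; set j := (size L)./2.
have sL : size L = j.*2.+1 by rewrite -[LHS]odd_double_half oL.
have jp p : p \in picks L -> (size (legs (weld a.2 p.1.2 (Diagram vs p.2 c))))./2 = j.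
  by move=> pL; rewrite size_map; have := size_picks pL; rewrite sL => -[->]; rewrite doubleK.
have jy y : (size (legs (Diagram vs ((y, a.2) :: L) c)))./2 = j.+1.
  have -> : size (legs (Diagram vs ((y, a.2) :: L) c)) = j.+1.*2 by rewrite doubleS -sL.
  exact: doubleK.
under [in RHS]eq_bigr => y _ do rewrite /gauss_int jy.
transitivity (\sum_(p <- picks L) delta x p.1.1 *:
    (if (j <= M)%N
     then (cf (M - j))^-1 *: gauss (M - j) (weld a.2 p.1.2 (Diagram vs p.2 c)) else 0)).
  by apply: eq_big_seq => p pL; rewrite /gauss_int jp.
case: (leqP j M) => jM; last first.
  rewrite big1 => [|p _]; last by rewrite scaler0.
  by rewrite big1 ?oppr0 // => y _; rewrite leqNgt ltnS (ltnW jM) scaler0.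
have wfx : wf (Diagram vs ((x, a.2) :: L) c) by [].
have v0 : gauss (M - j) (Diagram vs ((x, a.2) :: L) c) = 0.
  by apply: gauss_vanish => //=; rewrite sL -mul2n -mulnA -/M; move: jM; clearbody M; lia.
have := gauss_cons ev_iso l_sym (M - j) vs (x, a.2) L c; rewrite v0 /= => /esym/eqP.
rewrite addr_eq0 => /eqP E.
transitivity ((cf (M - j))^-1 *: \sum_(p <- picks L) delta x p.1.1 *:
    gauss (M - j) (weld a.2 p.1.2 (Diagram vs p.2 c))).
  by rewrite scaler_sumr; apply: eq_bigr => p _; rewrite !scalerA mulrC.
rewrite E scalerN scalerA; congr (- _).
case: ltnP => jM'; last first.
  (* [j = M]: there are no struts to expand along *)
  have -> : (M - j)%N = 0%N by apply/eqP; rewrite subn_eq0 -ltnS.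
  by rewrite muln0 mulr0 scale0r big1 // => y _; rewrite scaler0.
have [k kE] : exists k, (M - j)%N = k.+1 by exists (M - j.+1)%N; rewrite subnSK.
have -> : (M - j.+1)%N = k by rewrite subnS kE.
rewrite kE /= scaler_sumr; apply: eq_bigr => y _; rewrite !scalerA mulrC; congr (_ *: _).
congr (_ * _); rewrite /cf expnS factS.
have -> : (2 * 2 ^ k * (k.+1 * k`!))%N = (2 * k.+1 * (2 ^ k * k`!))%N by lia.
rewrite natrM invfM mulrAC mulVf ?mul1r //.
exact: (K_char0 (2 * k.+1).-1).
Qed.

(** Inverting [l] in the integration by parts formula gives the recursion of
    [wick] for the opposite of the inverse matrix.  The diagrams without legs
    provide the constant. *)
Lemma gauss_int_wick D : wf D -> ~~ odd (size (legs D)) ->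
  gauss_int D = ((-1) ^+ M * \det A ^+ m) *: wick ev (fun x y => - linv x y) D.
Proof.
case: D => vs L c /=.
elim: {L}(size L) {-2}L vs c (leqnn (size L)) => [|n IH] [|a L] vs c // sL wfL eL.
1,2: rewrite wick_nil /gauss_int /= subn0 (gauss_closed _ _ _).1 scalerA mulKf ?cf_neq0 //;
  by rewrite /e (newton_top m A).2.
rewrite wick_cons scaler_sumr; apply/esym.
transitivity (\sum_(p <- picks L) (- linv a.1 p.1.1) *:
    gauss_int (weld a.2 p.1.2 (Diagram vs p.2 c))).
  apply: eq_big_seq => p pL; rewrite IH; first by rewrite !scalerA mulrC.
  - by rewrite size_map (leq_size_picks pL) // ltnW.
  - by apply: (wf_weld_perm _ wfL); rewrite perm_cons perm_picks.
  - by rewrite size_map; move: eL; rewrite /= -(size_picks pL) /= negbK.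
transitivity (\sum_x (- linv a.1 x) *: \sum_(p <- picks L) delta x p.1.1 *:
    gauss_int (weld a.2 p.1.2 (Diagram vs p.2 c))).
  under [RHS]eq_bigr => x _ do rewrite scaler_sumr.
  rewrite [RHS]exchange_big; apply: eq_bigr => p _ /=.
  rewrite (bigD1 p.1.1) //= delta_refl scale1r big1 ?addr0 // => x /delta_neq ->.
  by rewrite scale0r scaler0.
transitivity (\sum_x \sum_y (linv a.1 x * l x y) *: gauss_int (Diagram vs ((y, a.2) :: L) c)).
  apply: eq_bigr => x _; rewrite gauss_int_parts //; last by move: eL; rewrite /= negbK.
  by rewrite scaleNr scalerN opprK scaler_sumr; apply: eq_bigr => y _; rewrite scalerA.
rewrite exchange_big /=; under eq_bigr => y _ do rewrite -scaler_suml linvK.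
by rewrite (delta_sum (fun y => gauss_int (Diagram vs ((y, a.2) :: L) c))); case: (a).
Qed.
End GaussIntegral.

(** * Compatibility with AS and IHX *)

(** Joining legs only renames the edges around the vertices, and relators are
    stable under renaming. *)
Section Relators.
Variables (K : fieldType) (V : lmodType K) (ev : diagram void -> V).
Variables (X : finType) (w : X -> X -> K).
Hypothesis ev_AS : forall a b c vs k,
  ev (Diagram ((a, b, c) :: vs) [::] k) + ev (Diagram ((b, a, c) :: vs) [::] k) = 0.
Hypothesis ev_IHX : forall a b c d e vs k,
  ev (Diagram ((a, b, e) :: (e, c, d) :: vs) [::] k)
  + ev (Diagram ((b, c, e) :: (e, a, d) :: vs) [::] k)
  + ev (Diagram ((c, a, e) :: (e, b, d) :: vs) [::] k) = 0.

Lemma wick_AS a b c vs (L : seq (X * nat)) k :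
  wick ev w (Diagram ((a, b, c) :: vs) L k) + wick ev w (Diagram ((b, a, c) :: vs) L k) = 0.
Proof.
elim: {L}(size L) {-2}L a b c vs k (leqnn (size L)) => [|n IH] [|p L] a b c vs k // sL;
  try exact: ev_AS.
rewrite !wick_cons -big_split big_seq big1 //= => q qL.
by rewrite -scalerDr IH ?scaler0 // size_map (leq_size_picks qL) // ltnW.
Qed.

Lemma wick_IHX a b c d e vs (L : seq (X * nat)) k :
  wick ev w (Diagram ((a, b, e) :: (e, c, d) :: vs) L k)
  + wick ev w (Diagram ((b, c, e) :: (e, a, d) :: vs) L k)
  + wick ev w (Diagram ((c, a, e) :: (e, b, d) :: vs) L k) = 0.
Proof.
elim: {L}(size L) {-2}L a b c d e vs k (leqnn (size L)) => [|n IH] [|p L] a b c d e vs k // sL;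
  try exact: ev_IHX.
rewrite !wick_cons -!big_split big_seq big1 //= => q qL.
by rewrite -!scalerDr IH ?scaler0 // size_map (leq_size_picks qL) // ltnW.
Qed.
End Relators.

(** * Quotient of a module by the span of a set *)

Section SpanQuotient.
Variables (K : fieldType) (U : lmodType K) (S : U -> Prop).

Definition in_span : {pred U} := fun u => `[< Defs.span S u >].

Lemma span_gen u : S u -> Defs.span S u.
Proof. by move=> Su; rewrite -[u]addr0 -[u]scale1r; apply: Defs.span_step Su (Defs.span0 _). Qed.

Lemma spanD u v : Defs.span S u -> Defs.span S v -> Defs.span S (u + v).
Proof.
elim=> [|c a b Sa _ IH] Sv; first by rewrite add0r.
by rewrite -addrA; apply: Defs.span_step Sa (IH Sv).
Qed.

Lemma spanZ c u : Defs.span S u -> Defs.span S (c *: u).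
Proof.
elim=> [|d a b Sa _ IH]; first by rewrite scaler0; apply: Defs.span0.
by rewrite scalerDr scalerA; apply: Defs.span_step Sa IH.
Qed.

Lemma in_span_zmod : zmod_closed in_span.
Proof.
split; first by apply/asboolP; apply: Defs.span0.
move=> u v /asboolP su /asboolP sv; apply/asboolP; apply: spanD => //.
by rewrite -scaleN1r; apply: spanZ.
Qed.

HB.instance Definition _ := GRing.isZmodClosed.Build U in_span in_span_zmod.

Definition span_quot := Quotient.quot in_span.
HB.instance Definition _ := GRing.Zmodule.on span_quot.

(** A name for the canonical surjection that can carry a linear structure. *)
Definition proj (u : U) : span_quot := \pi_span_quot%qT u.

Lemma proj_eq u v : proj u = proj v <-> Defs.span S (u - v).
Proof.
split=> [/eqP|h].
  by rewrite -Quotient.idealrBE => /asboolP.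
by apply/eqP; rewrite -Quotient.idealrBE; apply/asboolP.
Qed.

Lemma proj_surj x : exists u, x = proj u.
Proof. by exists (repr x); rewrite /proj reprK. Qed.

Lemma projD u v : proj (u + v) = proj u + proj v.
Proof. exact: (raddfD (\pi_(Quotient.quot in_span)%qT)). Qed.

Definition quot_scale (c : K) (x : span_quot) : span_quot := proj (c *: repr x).

Lemma quot_scaleE c u : quot_scale c (proj u) = proj (c *: u).
Proof.
apply/proj_eq; rewrite -scalerBr; apply: spanZ; apply/proj_eq.
by rewrite /proj reprK.
Qed.

Lemma quot_scaleA a b x : quot_scale a (quot_scale b x) = quot_scale (a * b) x.
Proof. by have [u ->] := proj_surj x; rewrite !quot_scaleE scalerA. Qed.

Lemma quot_scale1 : left_id 1 quot_scale.
Proof. by move=> x; have [u ->] := proj_surj x; rewrite quot_scaleE scale1r. Qed.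

Lemma quot_scaleDr : right_distributive quot_scale +%R.
Proof.
move=> a x y; have [u ->] := proj_surj x; have [v ->] := proj_surj y.
by rewrite -projD !quot_scaleE scalerDr projD.
Qed.

Lemma quot_scaleDl x : {morph quot_scale^~ x : a b / a + b}.
Proof.
move=> a b; have [u ->] := proj_surj x.
by rewrite /= !quot_scaleE scalerDl projD.
Qed.

HB.instance Definition _ := GRing.Zmodule_isLmodule.Build K span_quot
  quot_scaleA quot_scale1 quot_scaleDr quot_scaleDl.

Lemma proj_linear : linear proj.
Proof. by move=> a u v; rewrite projD; congr (_ + _); rewrite -quot_scaleE. Qed.

HB.instance Definition _ := GRing.isLinear.Build K U span_quot *:%R proj proj_linear.
End SpanQuotient.

(** * Gluing struts to a diagram *)

Lemma wf_join_legs ps vs c :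
  twice (flatten (map vertex_ends vs) ++ flatten [seq [:: p.1; p.2] | p <- ps]) ->
  wf (join_legs ps vs c).
Proof.
elim: {ps}(size ps) {-2}ps (erefl (size ps)) vs c => [|n IH] [|[e f] ps] //= sp vs c.
  by move=> h; rewrite wfE /ends /join_legs /= map_ren_vertex_id.
rewrite (perm_twice (_ : perm_eq _ (e :: f :: (flatten (map vertex_ends vs) ++
  flatten [seq [:: p.1; p.2] | p <- ps])))); last by rewrite (perm_catCA _ [:: e; f]).
move=> /twice_fuse h; rewrite join_legs_cons; apply: IH.
  by rewrite size_map; case: sp.
by move: h; rewrite map_cat !map_flatten -!map_comp.
Qed.

Lemma matchings_perm n s ps : ps \in matchings_rec n s ->
  perm_eq (flatten [seq [:: p.1; p.2] | p <- ps]) s.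
Proof.
elim: n s ps => [|n IH] [|a s] ps //=; rewrite ?inE; try by move=> /eqP ->.
case/flattenP => _ /mapP[p pL ->] /mapP[b /IH bp ->] /=.
by rewrite perm_cons; apply: perm_trans (perm_picks pL); rewrite perm_cons.
Qed.

Lemma leg_bijections_perm (X : eqType) (L M : seq (X * nat)) ps :
  ps \in leg_bijections L M ->
  perm_eq (flatten [seq [:: p.1; p.2] | p <- ps]) (map snd L ++ map snd M).
Proof.
elim: L M ps => [|a L IH] M ps /=; first by case: M => //; rewrite inE => /eqP ->.
case/flattenP => _ /mapP[p + ->] /mapP[b /IH bp ->] /=.
rewrite mem_filter => /andP[_ pL]; rewrite perm_cons.
have /(perm_map snd) /= pp := perm_picks pL.
rewrite -(permPr (_ : perm_eq (map snd L ++ p.1.2 :: map snd p.2) _)) ?perm_cat2l //.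
by rewrite -(cat1s p.1.2 (map snd p.2)) perm_sym perm_catCA perm_cons perm_sym.
Qed.

Lemma leg_bijections_map (X : eqType) rho (L M : seq (X * nat)) :
  {in map snd L, forall a, rho a = a} ->
  leg_bijections L (map (ren_leg rho) M) =
  [seq [seq (rho p.1, rho p.2) | p <- ps] | ps <- leg_bijections L M].
Proof.
elim: L M => [|a L IH] M h /=; first by case: M.
rewrite picks_map filter_map -map_comp map_flatten -!map_comp; congr flatten.
apply: eq_map => p /=; rewrite IH => [|b bL]; last by apply: h; rewrite inE bL orbT.
rewrite -!map_comp; apply: eq_map => b /=.
by rewrite (h a.2) // mem_head.
Qed.

Lemma size_leg_bijections (X : eqType) (L M : seq (X * nat)) ps :
  ps \in leg_bijections L M -> size L = size M.
Proof.
elim: L M ps => [|a L IH] M ps /=; first by case: M.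
case/flattenP => _ /mapP[p + ->] /mapP[b /IH + _].
by rewrite mem_filter => /andP[_ /size_picks <-] ->.
Qed.

(** [L] lists the ends of one strut after another, each strut with its own edge. *)
Fixpoint is_struts (X : eqType) (s : seq (X * X)) (L : seq (X * nat)) : bool :=
  match s, L with
  | [::], [::] => true
  | xy :: s', a :: b :: L' =>
      [&& a.1 == xy.1, b.1 == xy.2, a.2 == b.2, a.2 \notin map snd L' & is_struts s' L']
  | _, _ => false
  end.

Section ContractPairing.
Variables (K : fieldType) (V : lmodType K) (ev : diagram void -> V).
Hypothesis ev_iso : forall D D' : diagram void, diagram_iso D D' -> ev D = ev D'.
Variable X : finType.

(** The two ends of a strut, with the edge [a.2], are joined to the edges [e]
    and [f]; the effect on the other edges is that of joining [e] and [f].  The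
    edge is thereby renamed, so that both sides agree up to isomorphism only. *)
Lemma contract_join s (L M : seq (X * nat)) vs c :
  is_struts s L -> {in map snd L, forall a, a \notin ends (Diagram vs M c)} ->
  \sum_(ps <- leg_bijections L M) ev (join_legs ps vs c) = contract ev s (Diagram vs M c).
Proof.
elim: s L M vs c => [|[x y] s IH] [|a [|b L]] M vs c //=.
  case: M => [|? ?] _ _; last by rewrite big_nil.
  by rewrite big_seq1 /join_legs /= map_ren_vertex_id.
case/and5P=> /eqP ax /eqP bY /eqP ab aL sL fr.
rewrite big_flatten big_map big_filter big_seq_cond [RHS]big_seq_cond ax.
apply: eq_bigr => p /andP[pM px]; rewrite big_map big_flatten big_map big_filter.
rewrite big_seq_cond [RHS]big_seq_cond bY; apply: eq_bigr => q /andP[qp qy].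
rewrite big_map -ab.
set e := p.1.2; set f := q.1.2.
have pM' := perm_map snd (perm_picks pM); have qp' := perm_map snd (perm_picks qp).
have sub g : g \in [:: e, f & ends (Diagram vs q.2 c)] -> g \in ends (Diagram vs M c).
  rewrite !inE !mem_cat /= -(perm_mem pM') /= inE -(perm_mem qp') /= inE -/e -/f.
  by case/or4P=> ->; rewrite ?orbT.
have aM : a.2 \notin ends (Diagram vs M c) by apply: fr; rewrite mem_head.
have ae : (a.2 == e) = false by apply: contraNF aM => /eqP ->; rewrite sub ?mem_head.
have af : (a.2 == f) = false.
  by apply: contraNF aM => /eqP ->; rewrite sub // !inE eqxx orbT.
pose rho := fuse a.2 (fuse a.2 e f) \o fuse a.2 e.
have joinE b' : join_legs ((a.2, e) :: (a.2, f) :: b') vs c =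
    join_legs [seq (rho p.1, rho p.2) | p <- b'] (map (ren_vertex rho) vs) (c + (e == f)).
  rewrite join_legs_cons /= ae addn0 {1 4 5}/fuse ae join_legs_cons -!map_comp.
  congr (join_legs _ _ (c + nat_of_bool _)).
  by rewrite /fuse [f == e]eq_sym; case: (eqVneq e f) => [_|_]; rewrite ?eqxx ?af.
under eq_bigr => b' _ do rewrite joinE.
have rhoL g : g \in map snd L -> rho g = g.
  move=> gL; have gM : g \notin ends (Diagram vs M c) by apply: fr; rewrite !inE gL !orbT.
  have ge : (g == e) = false by apply: contraNF gM => /eqP ->; rewrite sub ?mem_head.
  have gf : (g == f) = false.
    by apply: contraNF gM => /eqP ->; rewrite sub // !inE eqxx orbT.
  have ga : (g == a.2) = false by apply: contraNF aL => /eqP <-.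
  by rewrite /rho /= /fuse ge; case: (f == e); rewrite ?ga ?gf.
have -> : \sum_(b' <- leg_bijections L q.2) ev (join_legs
     [seq (rho p.1, rho p.2) | p <- b'] (map (ren_vertex rho) vs) (c + (e == f))) =
   \sum_(b' <- leg_bijections L (map (ren_leg rho) q.2))
     ev (join_legs b' (map (ren_vertex rho) vs) (c + (e == f))).
  by rewrite leg_bijections_map // big_map.
rewrite IH //.
  have ker : {in ends (Diagram vs q.2 c) &,
      forall g h, (rho g == rho h) = (fuse e f g == fuse e f h)}.
    move=> g h gE hE.
    have ga : (g == a.2) = false.
      by apply: contraNF aM => /eqP <-; apply: sub; rewrite !inE gE !orbT.
    have ha : (h == a.2) = false.
      by apply: contraNF aM => /eqP <-; apply: sub; rewrite !inE hE !orbT.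
    move: ga ha ae af; rewrite /rho /= /fuse; clear -e f.
    by do !(case: eqP => //=); intros; subst; congruence.
  have [phi iso] := leg_iso_kernel ker (erefl (c + (e == f))%N).
  exact: contract_leg_iso iso.
move=> g gL; rewrite (ends_relabel _ _ _ _ c); apply/mapP => -[h hE gh].
have gM : g \notin ends (Diagram vs M c) by apply: fr; rewrite !inE gL !orbT.
have ga : (g == a.2) = false by apply: contraNF aL => /eqP <-.
have gh' : (g == h) = false.
  by apply: contraNF gM => /eqP ->; apply: sub; rewrite !inE hE !orbT.
move: gh ga gh'; rewrite /rho /= /fuse; do !case: eqP => //=; intros; subst; congruence.
Qed.
End ContractPairing.

(** * Linear extension *)

Section Lift.
Variables (K : fieldType) (V : lmodType K) (A : choiceType).

Definition linext (h : A -> V) (u : {malg K[A]}) : V :=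
  \sum_(a <- msupp u) u@_a *: h a.

Lemma linext_widen h (d : {fset A}) u : (msupp u `<=` d)%fset ->
  linext h u = \sum_(a <- d) u@_a *: h a.
Proof.
move=> ud; apply: big_fset_incl => // a _ au.
by rewrite mcoeff_outdom // scale0r.
Qed.

Lemma linext_linear h : linear (linext h).
Proof.
move=> c u v; pose d := (msupp u `|` msupp v)%fset.
rewrite !(@linext_widen _ d) ?fsubsetUl ?fsubsetUr //.
  rewrite scaler_sumr -big_split /=; apply: eq_bigr => a _.
  by rewrite mcoeffD mcoeffZ scalerDl scalerA.
apply: fsubset_trans (msuppD_le _ _) _; apply: fsetUSS => //.
exact: msuppZ_le.
Qed.

HB.instance Definition _ h :=
  GRing.isLinear.Build K {malg K[A]} V *:%R (linext h) (linext_linear h).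

Lemma linextU h a : linext h << a >> = h a.
Proof. by rewrite /linext msuppU oner_eq0 big_seq_fset1 mcoeffUU scale1r. Qed.

Lemma linextUB h a b : linext h (<< a >> - << b >>) = h a - h b.
Proof. by rewrite (linearB (linext h)) /= (linextU h a) (linextU h b). Qed.

Lemma linextUD h a b : linext h (<< a >> + << b >>) = h a + h b.
Proof. by rewrite (linearD (linext h)) /= (linextU h a) (linextU h b). Qed.

Lemma linextUDD h a b c : linext h (<< a >> + << b >> + << c >>) = h a + h b + h c.
Proof. by rewrite (linearD (linext h)) /= linextUD (linextU h c). Qed.

Lemma eq_linext h h' u : {in msupp u, h =1 h'} -> linext h u = linext h' u.
Proof. by move=> hh; apply: eq_big_seq => a au; rewrite hh. Qed.

Lemma linext0 u : linext (fun=> 0) u = 0.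
Proof. by rewrite /linext big1 // => a _; rewrite scaler0. Qed.

Lemma linextZ c h u : linext (fun a => c *: h a) u = c *: linext h u.
Proof. by rewrite scaler_sumr; apply: eq_bigr => a _; rewrite !scalerA mulrC. Qed.
End Lift.

Lemma linear_linext (K : fieldType) (V W : lmodType K) (A : choiceType)
    (f : {linear V -> W}) (h : A -> V) u :
  f (linext h u) = linext (fun a => f (h a)) u.
Proof. by rewrite linear_sum; apply: eq_bigr => a _; rewrite linearZ. Qed.

Lemma bilinear_extE (K : fieldType) (A B C : choiceType) (op : A -> B -> {malg K[C]}) u v :
  bilinear_ext op u v = linext (fun a => linext (op a) v) u.
Proof.
apply: eq_bigr => a _; rewrite scaler_sumr; apply: eq_bigr => b _.
by rewrite scalerA.
Qed.

(** * Series concentrated in one degree *)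

Section Single.
Variables (K : fieldType) (X : choiceType).

Definition single n (u : {malg K[diagram X]}) : series K X :=
  fun k => if k == n then u else 0.

Definition union_ext : {malg K[diagram X]} -> {malg K[diagram X]} -> {malg K[diagram X]} :=
  bilinear_ext (fun D E => << disjoint_union D E >>).

Lemma series_mul_single a u b v :
  series_mul (single a u) (single b v) = single (a + b) (union_ext u v).
Proof.
apply: functional_extensionality_dep => n; rewrite /series_mul /single.
have bil0 (f : {malg K[diagram X]}) : bilinear_ext (fun D E => << disjoint_union D E >>) 0 f
    = 0 :> {malg K[diagram X]} by rewrite bilinear_extE linear0.
have bil0r (f : {malg K[diagram X]}) : bilinear_ext (fun D E => << disjoint_union D E >>) f 0
    = 0 :> {malg K[diagram X]}.
  by rewrite bilinear_extE -[RHS](linext0 _ f); apply: eq_linext => D _; rewrite linear0.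
case: eqP => [->|nab].
  have ha : (a < (a + b).+1)%N by rewrite ltnS leq_addr.
  rewrite (bigD1 (Ordinal ha)) //= eqxx addKn eqxx big1 ?addr0 // => i ia.
  by rewrite ifN ?bil0 //; apply: contraNneq ia => ia; apply/eqP/val_inj.
rewrite big1 // => i _; case: eqP => [ia|_]; last exact: bil0.
case: eqP => [ib|_]; last exact: bil0r.
by case: nab; have := ltn_ord i; lia.
Qed.

Lemma series1E : series1 K X = single 0 << empty_diagram X >>.
Proof. by apply: functional_extensionality_dep => -[]. Qed.

Lemma singleZ c n u : c *: single n u = single n (c *: u).
Proof.
apply: functional_extensionality_dep => k.
transitivity (c *: single n u k) => //.
by rewrite /single; case: eqP => // _; rewrite scaler0.
Qed.

Definition union_pow u k := iter k (union_ext u) << empty_diagram X >>.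

Lemma union_powS u k : union_pow u k.+1 = union_ext u (union_pow u k).
Proof. by []. Qed.

Lemma series_pow_single u k : series_pow (single 1 u) k = single k (union_pow u k).
Proof.
elim: k => [|k IH]; first exact: series1E.
by rewrite /series_pow iterS -/(series_pow _ _) IH series_mul_single.
Qed.

Lemma series_exp_single u n : series_exp (single 1 u) n = n`!%:R^-1 *: union_pow u n.
Proof.
rewrite /series_exp (bigD1 ord_max) //= series_pow_single /single eqxx big1 ?addr0 // => i.
by rewrite series_pow_single /single -val_eqE /= eq_sym => /negPf ->; rewrite scaler0.
Qed.
End Single.

(** * Disjoint unions of struts *)

Lemma twice_cat s t : twice s -> twice t -> {in s, forall a, a \notin t} -> twice (s ++ t).
Proof.
move=> /twiceP hs /twiceP ht st; apply/twiceP => e; rewrite mem_cat count_cat.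
have [es _|es /= et] := boolP (e \in s); first by rewrite hs // (count_memPn (st e es)).
by rewrite ht // (count_memPn es).
Qed.

Lemma evens_inj : injective evens. Proof. exact: double_inj. Qed.
Lemma odds_inj : injective odds. Proof. by move=> a b [] /double_inj. Qed.
Lemma evens_odds a b : (evens a == odds b) = false.
Proof. by apply/eqP => /(congr1 odd); rewrite /= !odd_double. Qed.

Lemma evens_notin_odds s t : {in map evens s, forall a, a \notin map odds t}.
Proof.
by move=> _ /mapP[a _ ->]; apply/mapP => -[b _ /eqP]; rewrite evens_odds.
Qed.

Lemma ends_union X (D E : diagram X) :
  perm_eq (ends (disjoint_union D E)) (map evens (ends D) ++ map odds (ends E)).
Proof.
rewrite /ends /= !map_cat flatten_cat !map_flatten -!map_comp.
rewrite perm_catACA; exact: perm_refl.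
Qed.

Lemma wf_union X (D E : diagram X) : wf D -> wf E -> wf (disjoint_union D E).
Proof.
rewrite !wfE => wD wE; rewrite (perm_twice (ends_union D E)); apply: twice_cat.
- by rewrite twice_inj // => a b _ _; apply: evens_inj.
- by rewrite twice_inj // => a b _ _; apply: odds_inj.
- exact: evens_notin_odds.
Qed.

Section Struts.
Variable X : choiceType.
Implicit Types (s t : seq (X * X)) (D E : diagram X) (L M : seq (X * nat)).

Lemma is_struts_ren phi s L : injective phi ->
  is_struts s L -> is_struts s (map (ren_leg phi) L).
Proof.
move=> inj; elim: s L => [|xy s IH] [|a [|b L]] //= /and5P[-> -> /eqP -> aL /IH ->].
rewrite eqxx andbT /=; apply: contra aL; rewrite -map_comp => /mapP[c cL /= /inj ->].
exact: map_f.
Qed.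

Lemma is_struts_cat s t L M : is_struts s L -> is_struts t M ->
  {in map snd L, forall a, a \notin map snd M} -> is_struts (s ++ t) (L ++ M).
Proof.
move=> sL tM; elim: s L sL => [|xy s IH] [|a [|b L]] //= /and5P[-> -> -> aL sL] h /=.
rewrite IH ?andbT // => [|c cL]; last by apply: h; rewrite !inE cL !orbT.
by rewrite map_cat mem_cat negb_or aL h // mem_head.
Qed.

Lemma size_is_struts s L : is_struts s L -> size L = (size s).*2.
Proof.
by elim: s L => [|xy s IH] [|a [|b L]] //= /and5P[_ _ _ _ /IH ->].
Qed.

Definition struts s D : Prop :=
  [/\ verts D = [::], circles D = 0%N, wf D & is_struts s (legs D)].

Lemma struts_empty : struts [::] (empty_diagram X). Proof. by []. Qed.

Lemma struts_strut x y : struts [:: (x, y)] (strut_diagram x y).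
Proof. by split=> //=; rewrite !eqxx. Qed.

Lemma struts_union s t D E : struts s D -> struts t E -> struts (s ++ t) (disjoint_union D E).
Proof.
move=> [vD cD wD sD] [vE cE wE sE]; split=> /=.
- by rewrite vD vE.
- by rewrite cD cE.
- exact: wf_union.
- apply: is_struts_cat; [exact: is_struts_ren evens_inj sD|exact: is_struts_ren odds_inj sE|].
  have := @evens_notin_odds (map snd (legs D)) (map snd (legs E)).
  by rewrite -!map_comp.
Qed.

(** A disjoint union with struts that avoids the renaming of the edges of [D]. *)
Fixpoint add_struts s D : diagram X :=
  if s is (x, y) :: s' then add_struts s' (add_strut x y (fresh D) D) else D.

Section IsoInvariant.
Variables (U : Type) (h : diagram X -> U).
Hypothesis h_iso : forall D E, diagram_iso D E -> h D = h E.

Lemma add_struts_iso s D E : diagram_iso D E -> h (add_struts s D) = h (add_struts s E).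
Proof.
elim: s D E => [|[x y] s IH] D E DE /=; first exact: h_iso.
by apply/IH/iso_add_strut => //; apply: fresh_ends.
Qed.

Lemma add_struts_cat s M D : is_struts s M ->
  {in map snd M, forall a, a \notin ends D} ->
  h (Diagram (verts D) (legs D ++ M) (circles D)) = h (add_struts s D).
Proof.
elim: s M D => [|[x y] s IH] [|a [|b M]] D //=.
  by rewrite cats0; case: D.
case: a b => [x' a] [y' b] /= /and5P[/eqP -> /eqP -> /eqP <- aM sM] fr.
have aD : a \notin ends D by apply: fr; rewrite mem_head.
transitivity (h (Diagram (verts D) (legs (add_strut x y a D) ++ M) (circles D))).
  apply: h_iso; apply: diagram_iso_perm.
  by rewrite (perm_catCA (legs D) [:: (x, a); (y, a)]).
rewrite (IH M (add_strut x y a D)) //; last first.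
  move=> c cM; rewrite (perm_mem (ends_add_strut x y a D)) !inE.
  rewrite !negb_or fr ?inE ?cM ?orbT // andbT andbb.
  by apply: contraNneq aM => <-.
apply: add_struts_iso; apply: iso_add_strut; rewrite ?fresh_ends //.
by case: (D) => *; apply: diagram_iso_perm.
Qed.

(** After renaming, the struts are moved to the front one by one, each time
    keeping away from the names of the edges already in use. *)
Lemma union_add_struts s D E : struts s E -> h (disjoint_union D E) = h (add_struts s D).
Proof.
case=> vE cE _ sE.
pose D2 := Diagram (map (ren_vertex evens) (verts D)) (map (ren_leg evens) (legs D)) (circles D).
have -> : disjoint_union D E =
    Diagram (verts D2) (legs D2 ++ map (ren_leg odds) (legs E)) (circles D2).
  by rewrite /disjoint_union vE cE cats0 addn0.
have fr : {in map snd (map (ren_leg odds) (legs E)), forall a, a \notin ends D2}.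
  rewrite -map_comp => _ /mapP[a aE ->]; rewrite (ends_relabel _ _ _ _ (circles D)).
  by apply/mapP => -[b _ /eqP]; rewrite eq_sym evens_odds.
rewrite (add_struts_cat (is_struts_ren odds_inj sE) fr).
apply: add_struts_iso.
by have [phi /leg_iso_iso] := leg_iso_renumber D evens_inj.
Qed.
End IsoInvariant.
End Struts.

Section StrutWords.
Variables (K : fieldType) (V : lmodType K) (X : finType).
Implicit Types (c : X -> X -> K) (g : seq (X * X) -> V).

Lemma eq_strut_words c k g g' : (forall s, size s = k -> g s = g' s) ->
  strut_words c k g = strut_words c k g'.
Proof.
elim: k g g' => [|k IH] g g' gg /=; first exact: gg.
apply: eq_bigr => x _; apply: eq_bigr => y _; congr (_ *: _).
by apply: IH => s sk; apply: gg; rewrite /= sk.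
Qed.

Lemma strut_words0 c k : strut_words c k (fun=> 0 : V) = 0.
Proof.
elim: k => [|k IH] //=; rewrite big1 // => x _; rewrite big1 // => y _.
by rewrite IH scaler0.
Qed.

Lemma strut_wordsZ a c k g :
  strut_words (fun x y => a * c x y) k g = a ^+ k *: strut_words c k g.
Proof.
elim: k g => [|k IH] g /=; first by rewrite expr0 scale1r.
rewrite scaler_sumr; apply: eq_bigr => x _; rewrite scaler_sumr; apply: eq_bigr => y _.
by rewrite IH !scalerA exprS; congr (_ *: _); ring.
Qed.

Lemma strut_words_scale c k g a :
  strut_words c k (fun s => a *: g s) = a *: strut_words c k g.
Proof.
elim: k g => [|k IH] g //=.
rewrite scaler_sumr; apply: eq_bigr => x _; rewrite scaler_sumr; apply: eq_bigr => y _.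
by rewrite IH !scalerA mulrC.
Qed.

Lemma strut_words_linext (A : choiceType) c k (h : seq (X * X) -> A -> V) u :
  strut_words c k (fun s => linext (h s) u) =
  linext (fun a => strut_words c k (h^~ a)) u.
Proof.
rewrite {1}/linext strut_words_sum; apply: eq_bigr => a _.
exact: strut_words_scale.
Qed.

Definition strut_sum c : {malg K[diagram X]} :=
  \sum_x \sum_y c x y *: << strut_diagram x y >>.

(** A function that depends only on the labels of the struts can be summed over
    words of struts. *)
Lemma linext_union_pow (h : diagram X -> V) g c k :
  (forall s D, size s = k -> struts s D -> h D = g s) ->
  linext h (union_pow (strut_sum c) k) = strut_words c k g.
Proof.
elim: k h g => [|k IH] h g hg.
  by rewrite /union_pow /= linextU; apply: hg => //; apply: struts_empty.
rewrite /union_pow iterS -/(union_pow _ _) /union_ext bilinear_extE.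
set v := union_pow _ _.
rewrite linear_linext {1}/strut_sum [LHS]linear_sum.
apply: eq_bigr => x _; rewrite [LHS]linear_sum; apply: eq_bigr => y _.
rewrite linearZ; congr (_ *: _); rewrite /= linextU linear_linext.
apply: IH => s D sk sD; rewrite /= linextU; apply: hg; first by rewrite /= sk.
exact: (struts_union (struts_strut x y) sD).
Qed.

Lemma gauss_words (ev : diagram void -> V) (l : X -> X -> K) k (D : diagram X) :
  strut_words l k (fun s => wick ev (@delta K X) (add_struts s D)) = gauss ev l k D.
Proof.
elim: k D => [|k IH] D //=; apply: eq_bigr => x _; apply: eq_bigr => y _.
by rewrite IH.
Qed.
End StrutWords.

(** * Evaluation of closed diagrams *)

(** All that matters of the projection [pr] to the quotient is that it is linear
    and kills the relators. *)
Section ClosedSpace.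
Variables (K : fieldType) (m : nat).

Variables (V : lmodType K) (pr : {linear {malg K[diagram void]} -> V}).
Hypothesis pr_relator : forall u, closed_relator m u -> pr u = 0.

(** Only well-formed diagrams may be replaced by isomorphic ones; sending all
    others to [0] makes [ev] invariant under all isomorphisms. *)
Definition ev (D : diagram void) : V := if wf D then pr << D >> else 0.

Lemma pr_relatorB u v : closed_relator m (u - v) -> pr u = pr v.
Proof. by move=> /pr_relator; rewrite linearB => /eqP; rewrite subr_eq0 => /eqP. Qed.

Lemma evE D : wf D -> ev D = pr << D >>.
Proof. by rewrite /ev => ->. Qed.

Lemma ev_iso (D D' : diagram void) : diagram_iso D D' -> ev D = ev D'.
Proof.
move=> DD'.
rewrite /ev.
have e := iso_wf DD'.
rewrite -e.
case wD: (wf D); last first.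
  reflexivity.

apply: pr_relatorB.
apply: rel_basic.
apply: rel_iso; [exact: wD| |exact: DD'].
by rewrite -(iso_wf DD').
Qed.

Lemma ev_O vs c :
  ev (Diagram vs [::] c.+1) = (- (2 * m)%:R) *: ev (Diagram vs [::] c).
Proof.
rewrite /ev; have -> : wf (Diagram vs [::] c.+1 : diagram void) =
    wf (Diagram vs [::] c : diagram void) by [].
case wD: (wf _); last by rewrite scaler0.
rewrite -[RHS]linearZ; apply: pr_relatorB.
exact: (@rel_O _ _ (Diagram vs [::] c)).
Qed.

Lemma ev_P (D : diagram unit) : wf D -> size (legs D) = (2 * m + 2)%N ->
  \sum_(ps <- matchings (map snd (legs D))) ev (join_legs ps (verts D) (circles D)) = 0.
Proof.
move=> wD sD; rewrite -[RHS](pr_relator (rel_P K wD sD)) linear_sum.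
apply: eq_big_seq => ps pD; apply/evE/wf_join_legs.
rewrite (@perm_twice _ (ends D)) // /ends perm_cat2l.
exact: matchings_perm pD.
Qed.

Lemma ev_AS a b c vs k :
  ev (Diagram ((a, b, c) :: vs) [::] k) + ev (Diagram ((b, a, c) :: vs) [::] k) = 0.
Proof.
rewrite /ev.
have -> : wf (Diagram ((b, a, c) :: vs) [::] k : diagram void) =
    wf (Diagram ((a, b, c) :: vs) [::] k : diagram void).
  rewrite !wfE; apply: perm_twice; rewrite /ends /= !cats0.
  by rewrite (perm_catCA [:: b] [:: a]).
case wD: (wf _); last exact: addr0.
by rewrite -linearD; apply/pr_relator/rel_basic/rel_AS.
Qed.

Lemma ev_IHX a b c d e vs k :
  ev (Diagram ((a, b, e) :: (e, c, d) :: vs) [::] k)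
  + ev (Diagram ((b, c, e) :: (e, a, d) :: vs) [::] k)
  + ev (Diagram ((c, a, e) :: (e, b, d) :: vs) [::] k) = 0.
Proof.
have rot a' b' c' : wf (Diagram ((b', c', e) :: (e, a', d) :: vs) [::] k : diagram void) =
    wf (Diagram ((a', b', e) :: (e, c', d) :: vs) [::] k : diagram void).
  rewrite !wfE; apply: perm_twice; apply/seq.permP => p; rewrite /ends /=; lia.
rewrite /ev (rot b c a) (rot a b c); case wD: (wf _); last by rewrite !addr0.
by rewrite -!linearD; apply/pr_relator/rel_basic/rel_IHX.
Qed.

Variable X : finType.
Implicit Types (D E : diagram X).

Lemma pr_pairing s D E : struts s D -> wf E ->
  pr (pairing_diagram K D E) = contract ev s E.
Proof.
case=> vD cD wD sD wE; rewrite /pairing_diagram linear_sum.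
transitivity (\sum_(ps <- leg_bijections (map (ren_leg evens) (legs D))
                                         (map (ren_leg odds) (legs E)))
    ev (join_legs ps (map (ren_vertex odds) (verts E)) (circles E))).
  apply: eq_big_seq => ps psDE; rewrite vD cD /= add0n evE //; apply: wf_join_legs.
  have := wf_union wD wE; rewrite wfE => h; rewrite -(perm_twice (_ : perm_eq
    (ends (disjoint_union D E)) _)) //.
  rewrite /ends /= vD /= perm_cat2l map_cat perm_sym.
  exact: leg_bijections_perm psDE.
rewrite (contract_join ev_iso (is_struts_ren evens_inj sD)); last first.
  have := @evens_notin_odds (map snd (legs D)) (ends E).
  rewrite -(ends_relabel _ _ _ (circles E) (circles E)) -!map_comp.
  by case: (E).
have [phi iso] := leg_iso_renumber E odds_inj.
by rewrite (contract_leg_iso ev_iso s iso).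
Qed.

(** Gluing preserves the vertices and removes all legs, so all terms of the
    gluing of [D] and [E] have the same degree. *)
Definition pairing_part n D E : {malg K[diagram void]} :=
  if (size (verts D) + size (verts E) == n.*2)%N then pairing_diagram K D E else 0.

Lemma degree_partE n (u : {malg K[diagram void]}) :
  degree_part n u = linext (fun C : diagram void =>
    if has_degree n C then << C >> else 0 : {malg K[diagram void]}) u.
Proof.
unfold degree_part.
unfold linext.
rewrite [LHS]big_mkcond.
apply: eq_bigr => C _.
case: (has_degree n C); first reflexivity.
by rewrite scaler0.
Qed.

Lemma degree_part_bilinear n u v :
  degree_part n (bilinear_ext (@pairing_diagram K X) u v) =
  linext (fun D => linext (pairing_part n D) v) u.
Proof.
rewrite degree_partE bilinear_extE linear_linext; apply: eq_linext => D _.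
rewrite /= linear_linext; apply: eq_linext => E _ /=.
rewrite /pairing_part /pairing_diagram linear_sum /=.
have hd ps : has_degree n (join_legs ps (map (ren_vertex evens) (verts D) ++
    map (ren_vertex odds) (verts E)) (circles D + circles E)) =
    (size (verts D) + size (verts E) == n.*2)%N.
  by rewrite /has_degree /= size_map size_cat !size_map addn0.
case: ifP => h; last by rewrite big1 // => ps _; rewrite linextU hd h.
by apply: eq_bigr => ps _; rewrite linextU hd h.
Qed.

(** All legs of the [size s] struts are glued, hence [E] has [2 size s] legs and
    [2n] vertices. *)
Lemma pairing_part_eq0 n s D E j : struts s D -> has_degree j E ->
  j != (n + size s)%N -> pairing_part n D E = 0.
Proof.
move=> [vD _ _ sD] dE; apply: contraNeq; rewrite /pairing_part vD.
case nE: (_ == n.*2)%N; last by rewrite eqxx.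
case bij : (leg_bijections (map (ren_leg evens) (legs D)) (map (ren_leg odds) (legs E))) => [|ps r].
  by rewrite /pairing_diagram bij big_nil eqxx.
have := @size_leg_bijections X (map (ren_leg evens) (legs D)) (map (ren_leg odds) (legs E)) ps.
rewrite bij mem_head !size_map (size_is_struts sD) => /(_ isT) sE _.
by move: dE nE; rewrite /has_degree -sE /=; lia.
Qed.

(** Every leg ends on an edge of its own, whose other end is at a vertex. *)
Lemma strutless_size E : wf E -> strutless E -> (size (legs E) <= 3 * size (verts E))%N.
Proof.
move=> /twiceP wE uE.
have -> : (3 * size (verts E))%N = size (flatten (map vertex_ends (verts E))).
  by elim: (verts E) => //= v vs IH; rewrite mulnS IH.
rewrite -(size_map snd); apply: uniq_leq_size => // e eL.
have := wE e; rewrite mem_cat eL orbT => /(_ isT); rewrite count_cat (count_uniq_mem e uE).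
have [//|/count_memPn ->] := boolP (e \in flatten _).
by case: (_ \in _).
Qed.
End ClosedSpace.

(** * The two integrals *)

Section Assembly.
Variables (K : fieldType) (m : nat) (V : lmodType K) (pr : {linear {malg K[diagram void]} -> V}).
Hypothesis K_char0 : forall n, n.+1%:R != 0 :> K.
Hypothesis pr_relator : forall u, closed_relator m u -> pr u = 0.
Variables (X : finType) (l : X -> X -> K).
Hypothesis l_sym : forall x y, l x y = l y x.
Hypothesis l_inv : Lambda l \in unitmx.
Implicit Types (D E : diagram X).
Local Notation ev := (ev pr).
Local Notation delta := (@delta K X).
Local Notation linv := (Lambda_inv l).
Let M := (m * #|X|)%N.

Let ev_iso := ev_iso pr_relator.

Lemma nat_neq0 n : (0 < n)%N -> n%:R != 0 :> K.
Proof. by case: n => // n _; apply: K_char0. Qed.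

Lemma Lambda_invK x y : \sum_z linv x z * l z y = delta x y.
Proof.
have := congr1 (fun A : 'M_ _ => A (enum_rank x) (enum_rank y)) (mulVmx l_inv).
rewrite !mxE (inj_eq enum_rank_inj) sum_enum_rank => e; apply: etrans _ e.
by apply: eq_bigr => z _; rewrite mxE !enum_rankK.
Qed.

Lemma Lambda_inv_sym x y : linv x y = linv y x.
Proof.
have symL : (Lambda l)^T = Lambda l by apply/matrixP => i j; rewrite !mxE l_sym.
by rewrite /Lambda_inv -[in LHS]symL -trmx_inv mxE.
Qed.

(** The negative-dimensional integral of a single diagram. *)
Definition top_part E : V :=
  if size (legs E) == (2 * m * #|X|)%N then wick ev delta E else 0.

Lemma top_part_iso D E : diagram_iso D E -> top_part D = top_part E.
Proof.
move=> iso; rewrite /top_part (wick_iso ev_iso (@delta_sym K X) iso).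
by have [phi [_ _ /perm_size -> _]] := iso; rewrite size_map.
Qed.

Lemma top_part_relator u : basic_relator u -> linext top_part u = 0.
Proof.
case=> [D D' wD wD' iso|a b c vs L k wD|a b c d e vs L k wD].
- by rewrite linextUB (top_part_iso iso) subrr.
- rewrite linextUD /top_part [legs _]/= [legs (Diagram _ _ _)]/=; case: eqP => _; last exact: addr0.
  exact: wick_AS (ev_AS pr_relator) _ _ _ _ _ _.
- rewrite linextUDD /top_part [legs _]/= [legs (Diagram _ _ _)]/=.
  case: eqP => _; last by rewrite !addr0.
  exact: wick_IHX (ev_IHX pr_relator) _ _ _ _ _ _ _ _.
Qed.

(** The integrand is known only up to AS, IHX and isomorphism. *)
Lemma top_part_span u v : Defs.span (@basic_relator K X) (u - v) ->
  linext top_part u = linext top_part v.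
Proof.
move=> uv; apply/eqP; rewrite -subr_eq0 -linearB /=; apply/eqP.
elim: uv => [|c a b /top_part_relator ra _ rb]; first exact: linear0.
by rewrite (linearP (linext top_part)) /= ra rb scaler0 addr0.
Qed.

Lemma union_extZU a b D E :
  union_ext (a *: << D >>) (b *: << E >>) =
  (a * b) *: << disjoint_union D E >> :> {malg K[diagram X]}.
Proof. by rewrite /union_ext bilinear_extE linearZ /= linextU linearZ /= linextU scalerA. Qed.

Lemma strutE x y : strut K x y = single 1 << strut_diagram x y >> :> series K X.
Proof. by apply: functional_extensionality_dep => -[|[|n]]. Qed.

(** The operator that is paired with the integrand is a multiple of a single
    disjoint union of struts. *)
Lemma top_seriesE : exists2 D0, struts (map (fun x => (x, x)) (top_word m X)) D0 &
  \big[@series_mul K X/@series1 K X]_(x : X)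
     ((m`!%:R)^-1 *: series_pow (2%:R^-1 *: strut K x x) m) =
  single M (((2 ^ m * m`!) ^ #|X|)%:R^-1 *: << D0 >>) :> series K X.
Proof.
rewrite /M /top_word cardE [index_enum _]unlock -enumT.
elim: (enum X) => [|x s [D sD IH]] /=.
  exists (empty_diagram X); first exact: struts_empty.
  by rewrite big_nil series1E muln0 invr1 scale1r.
have [C sC CE] : exists2 C, struts (map (fun x => (x, x)) (nseq m x)) C &
    union_pow (2%:R^-1 *: << strut_diagram x x >>) m =
    2%:R^-1 ^+ m *: << C >> :> {malg K[diagram X]}.
  elim: (m) => [|k [C sC CE]].
    by exists (empty_diagram X); [exact: struts_empty | rewrite expr0 scale1r].
  exists (disjoint_union (strut_diagram x x) C).
    exact: (struts_union (struts_strut x x) sC).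
  rewrite union_powS CE.
  rewrite (union_extZU _ _ (strut_diagram x x) C).
  rewrite -exprS.
  reflexivity.
exists (disjoint_union C D).
  by rewrite map_cat; apply: struts_union.
rewrite big_cons IH strutE singleZ series_pow_single singleZ series_mul_single mulnS CE.
rewrite scalerA.
rewrite (union_extZU _ _ C D).
have <- : m`!%:R^-1 * 2%:R^-1 ^+ m * ((2 ^ m * m`!) ^ size s)%:R^-1 =
    ((2 ^ m * m`!) ^ (size s).+1)%:R^-1 :> K.
  by rewrite expnS natrM invfM; congr (_ * _); rewrite natrM natrX invfM exprVn mulrC.
reflexivity.
Qed.

(** In this degree, [E] has [2M] legs exactly when it has [2n] vertices. *)
Lemma pr_pairing_top D0 n E : struts (map (fun x => (x, x)) (top_word m X)) D0 ->
  wf E -> has_degree (n + M) E ->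
  pr (pairing_part K n D0 E) = ((2 ^ m * m`!) ^ #|X|)%:R *: top_part E.
Proof.
move=> sD wE dE; have [vD _ _ _] := sD; rewrite /pairing_part /top_part vD add0n.
have -> : (size (verts E) == n.*2) = (size (legs E) == (2 * m * #|X|)%N).
  by move: dE; rewrite /has_degree -mulnA -/M; move: M => N; lia.
case sE: (_ == _); last by rewrite linear0 scaler0.
rewrite (pr_pairing pr_relator sD wE).
by rewrite (contract_top ev_iso (ev_P pr_relator)) // sE.
Qed.

(** Degree [n] of the integral only involves the part of [G] of degree [n + M],
    because [2M] legs are glued. *)
Lemma int_negE n (G : series K X) : in_B G ->
  pr (int_neg m G n) = linext top_part (G (n + M)%N).
Proof.
move=> G_B; have [D0 sD topE] := top_seriesE; rewrite /int_neg topE /pairing.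
set kappa := (_%:R)^-1.
have size_top : size (map (fun x => (x, x)) (top_word m X)) = M.
  rewrite size_map /top_word size_flatten /shape -map_comp sumnE big_map big_enum /=.
  by under eq_bigr => x _ do rewrite size_nseq; rewrite sum_nat_const mulnC.
rewrite (fsbigE [:: (M, (n + M)%N)]) //; last first.
  move=> [i j] _; rewrite inE xpair_eqE negb_and degree_part_bilinear /= /single.
  case: (eqVneq i M) => [_ /= jn|_ _]; last exact: linear0.
  rewrite linearZ /= (linextU _ D0) -[X in _ *: X](_ : 0 = _) ?scaler0 //.
  rewrite -[LHS](linext0 _ (G j)); apply: eq_linext => E EG.
  have /and3P[_ _ dE] := G_B j E EG.
  by rewrite (pairing_part_eq0 K sD dE) // size_top.
rewrite big_cons big_nil mem_setT /= addr0 degree_part_bilinear /single eqxx.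
rewrite linearZ /= (linextU _ D0) linearZ (linear_linext pr) /=.
rewrite -linextZ; apply: eq_linext => E EG; have /and3P[wE _ dE] := G_B _ E EG.
rewrite (pr_pairing_top sD wE dE) scalerA mulVf ?scale1r //.
by apply: nat_neq0; rewrite expn_gt0 muln_gt0 expn_gt0 fact_gt0.
Qed.

Lemma quadraticE a (c : X -> X -> K) :
  a *: quadratic c = single 1 (strut_sum (fun x y => a * 2%:R^-1 * c x y)) :> series K X.
Proof.
apply: functional_extensionality_dep => k.
transitivity (a *: (2%:R^-1 *: \sum_x \sum_y c x y *: strut K x y k)).
  rewrite /quadratic; congr (_ *: (_ *: _)).
  by rewrite fct_sumE; apply: eq_bigr => x _; rewrite fct_sumE.
rewrite /single /strut_sum scalerA.
case: eqP => [->|k1].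
  rewrite scaler_sumr; apply: eq_bigr => x _; rewrite scaler_sumr.
  by apply: eq_bigr => y _; rewrite scalerA.
rewrite big1 ?scaler0 // => x _; rewrite big1 // => y _.
by case: k k1 => [|[|k]] // _; rewrite scaler0.
Qed.

Lemma size_add_struts s D : size (legs (add_struts s D)) = (size (legs D) + (size s).*2)%N.
Proof.
elim: s D => [|[x y] s IH] D /=; first by rewrite addn0.
by rewrite IH /= doubleS !addnS.
Qed.

Definition gauss_part n D : V :=
  if size (verts D) == n.*2 then gauss_int ev m l D else 0.

(** In the product of [D] with the exponential, the term with [k] struts has [2M]
    legs precisely when [D] has [2n] vertices, and its integral is the one in
    [gauss_int]. *)
Lemma linext_top_union n k j D : wf D -> has_degree j D -> (j + k = n + M)%N ->
  linext (fun E => top_part (disjoint_union D E)) (series_exp (quadratic l) k) =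
  gauss_part n D.
Proof.
move=> wD dD jk; rewrite -[quadratic l]scale1r quadraticE series_exp_single linearZ /=.
rewrite (@linext_union_pow _ _ _ _ (fun s => top_part (add_struts s D))); last first.
  by move=> s E _ sE; apply: union_add_struts sE; apply: top_part_iso.
have legsE : (size (legs D) + k.*2 == (2 * m * #|X|)%N) = (size (verts D) == n.*2).
  by move: dD jk; rewrite /has_degree -mulnA -/M; move: M => N; lia.
rewrite strut_wordsZ mul1r.
rewrite (@eq_strut_words _ _ _ _ _ _ (fun s => if size (verts D) == n.*2
    then wick ev delta (add_struts s D) else 0)); last first.
  by move=> s sk; rewrite /top_part size_add_struts sk legsE.
rewrite /gauss_part; case vD: (_ == _); last by rewrite strut_words0 !scaler0.
rewrite gauss_words scalerA /gauss_int -/M.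
have kM : (size (legs D))./2 = (M - k)%N /\ (k <= M)%N.
  by move: legsE; rewrite vD -mulnA -/M; move: M => N; lia.
rewrite kM.1 leq_subr subKn ?kM.2 //; congr (_ *: _).
by rewrite natrM invfM natrX exprVn mulrC.
Qed.

Lemma linext_top_gauss n (P : series K X) : in_B P ->
  linext top_part (series_mul P (series_exp (quadratic l)) (n + M)%N) =
  \sum_(j < (n + M).+1) linext (gauss_part n) (P j).
Proof.
move=> P_B; rewrite /series_mul [LHS]linear_sum; apply: eq_bigr => j _.
rewrite bilinear_extE (linear_linext (linext top_part)); apply: eq_linext => D DP.
have /and3P[wD _ dD] := P_B _ D DP.
rewrite -(@linext_top_union n (n + M - j) j) //; last by have := ltn_ord j; lia.
rewrite (linear_linext (linext top_part)); apply: eq_linext => E _ /=.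
exact: linextU.
Qed.

Definition wick_part n D : V :=
  if size (verts D) == n.*2 then wick ev (fun x y => - linv x y) D else 0.

Let coef : K := (-1) ^+ M * \det (Lambda l) ^+ m.

Lemma gauss_part_wick n j D : wf D -> has_degree j D ->
  gauss_part n D = coef *: wick_part n D.
Proof.
move=> wD dD; rewrite /gauss_part /wick_part; case vD: (_ == _); last by rewrite scaler0.
apply: (gauss_int_wick K_char0 ev_iso (ev_O pr_relator) (ev_P pr_relator) l_sym) => //.
  exact: Lambda_invK.
by move: dD vD; rewrite /has_degree; lia.
Qed.

(** Then [D] has more than [2M] legs. *)
Lemma gauss_part_large n j D : has_degree j D -> (n + M < j)%N -> gauss_part n D = 0.
Proof.
move=> dD jM; rewrite /gauss_part; case vD: (_ == _) => //; rewrite /gauss_int ifN //.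
by move: dD jM vD; rewrite /has_degree -/M; move: M => N; lia.
Qed.

Lemma wick_part_small n j D : has_degree j D -> (j < n)%N -> wick_part n D = 0.
Proof.
move=> dD jM; rewrite /wick_part; case vD: (_ == _) => //.
by exfalso; move: dD jM vD; rewrite /has_degree; lia.
Qed.

(** A term with [i] struts contributes to degree [n] only through diagrams with
    [2i] legs and [2n] vertices; for strutless diagrams this forces [i <= 3 n],
    and larger bounds [B] merely add zeros. *)
Lemma int_FGE n B (P : series K X) : in_Bplus P -> (3 * n < B)%N ->
  pr (int_FG l P n) = \sum_(i < B) linext (wick_part n) (P (n + i)%N).
Proof.
move=> [P_B P_str] nB; rewrite /int_FG -scaleN1r quadraticE.
set c := fun x y : X => _; rewrite /pairing.
pose r := [seq (i, (n + i)%N) | i <- iota 0 B].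
rewrite (fsbigE r) //; first last.
- move=> [i j] _ ijr; rewrite degree_part_bilinear /= series_exp_single linearZ /=.
  rewrite (@linext_union_pow _ _ _ _ (fun=> 0)) ?strut_words0 ?scaler0 //.
  move=> s D si sD; rewrite -[RHS](linext0 _ (P j)); apply: eq_linext => E EP.
  have /and3P[wE _ dE] := P_B j E EP.
  have [jE|jE] := eqVneq j (n + size s)%N; last exact: pairing_part_eq0 sD dE jE.
  rewrite /pairing_part; case vE: (_ == _) => //; exfalso.
  have := strutless_size wE (P_str _ _ EP).
  have iB : (B <= i)%N.
    rewrite leqNgt; apply: contra ijr => iB; apply/mapP; exists i; last by rewrite jE si.
    by rewrite mem_iota add0n.
  have [vD _ _ _] := sD; move: vE dE; rewrite /has_degree vD jE si /=; lia.
- by rewrite map_inj_uniq ?iota_uniq // => a b [].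
rewrite big_mkcond /=.
under eq_bigr => p _ do rewrite mem_setT.
rewrite big_map -/(index_iota 0 B) -{1}[B]subn0 -/(index_iota 0 B) big_mkord linear_sum.
apply: eq_bigr => i _.
rewrite degree_part_bilinear /= series_exp_single linearZ /= linearZ.
rewrite (linear_linext pr).
rewrite (@linext_union_pow _ _ _ _ (fun s => linext (fun E =>
   if size (verts E) == n.*2 then contract ev s E else 0) (P (n + i)%N))); last first.
  move=> s D si sD; rewrite (linear_linext pr); apply: eq_linext => E EP.
  have /and3P[wE _ dE] := P_B _ E EP; have [vD _ _ _] := sD.
  rewrite /= /pairing_part vD /=; case vE: (_ == _); last exact: linear0.
  exact: (pr_pairing pr_relator sD wE).
rewrite strut_words_linext /= -linextZ; apply: eq_linext => E EP.
have /and3P[wE _ dE] := P_B _ E EP.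
rewrite /wick_part; case vE: (_ == _); last by rewrite strut_words0 scaler0.
have -> : c = (fun x y => 2%:R^-1 * (- linv x y)).
  apply: functional_extensionality_dep => x; apply: functional_extensionality_dep => y.
  by rewrite /c mulN1r mulNr mulrN.
rewrite strut_wordsZ contract_exp //; last by move=> x y; rewrite Lambda_inv_sym.
have -> : size (legs E) == i.*2.
  by move: dE; rewrite /has_degree (eqP vE) doubleD eqn_add2l.
rewrite !scalerA natrM natrX exprVn -[RHS]scale1r; congr (_ *: _).
have f0 : i`!%:R != 0 :> K by apply: nat_neq0; apply: fact_gt0.
have p0 : 2%:R ^+ i != 0 :> K by rewrite expf_neq0 // nat_neq0.
rewrite -invfM [2%:R ^+ i * _]mulrC.
by rewrite mulVf // mulf_neq0.
Qed.

(** Both integrals are sums over the diagrams of [P] with [2n] vertices.  The ranges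
    of the degrees differ, but outside of either range the summands vanish:
    above [n + M] the Gaussian integral is zero, and below [n] there are no such
    diagrams. *)
Lemma int_neg_int_FG n (G P : series K X) :
  in_B G -> in_Bplus P -> eq_B G (series_mul P (series_exp (quadratic l))) ->
  pr (int_neg m G n) = coef *: pr (int_FG l P n).
Proof.
move=> G_B P_Bplus GP; have [P_B _] := P_Bplus.
apply: etrans (int_negE n G_B) _.
apply: etrans (top_part_span (GP (n + M)%N)) _.
apply: etrans (linext_top_gauss n P_B) _.
(* large enough for both ranges of degrees *)
pose B := (3 * n + 1 + M)%N.
rewrite (@int_FGE n B) //; last by rewrite /B addn1 addSn ltnS leq_addr.
have FG j : linext (gauss_part n) (P j) = coef *: linext (wick_part n) (P j).
  rewrite -linextZ; apply: eq_linext => D DP; have /and3P[wD _ dD] := P_B _ D DP.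
  exact: gauss_part_wick wD dD.
have G0 j : (n + M < j)%N -> linext (gauss_part n) (P j) = 0.
  move=> jM; rewrite -[RHS](linext0 _ (P j)); apply: eq_linext => D DP.
  by have /and3P[_ _ dD] := P_B _ D DP; apply: gauss_part_large dD jM.
have W0 j : (j < n)%N -> linext (wick_part n) (P j) = 0.
  move=> jM; rewrite -[RHS](linext0 _ (P j)); apply: eq_linext => D DP.
  by have /and3P[_ _ dD] := P_B _ D DP; apply: wick_part_small dD jM.
have eB : ((n + M).+1 <= n + B)%N by rewrite /B; lia.
transitivity (\sum_(0 <= j < n + B) linext (gauss_part n) (P j)).
  rewrite (big_cat_nat (leq0n _) eB) //= big_mkord [X in _ = _ + X]big_nat_cond.
  by rewrite [X in _ = _ + X]big1 ?addr0 // => j /andP[/andP[jM _] _]; apply: G0.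
rewrite (eq_bigr _ (fun j _ => FG j)) -scaler_sumr; congr (_ *: _).
rewrite (big_cat_nat (leq0n n) (leq_addr B n)) //= big_nat_cond big1 ?add0r; last first.
  by move=> j /andP[/andP[_ jn] _]; apply: W0.
rewrite -{1}[n]add0n big_addn addKn big_mkord; apply: eq_bigr => i _.
by rewrite addnC.
Qed.
End Assembly.

Theorem proposition1p3 (K : fieldType) (K_char0 : [pchar K] =i pred0)
    (X : finType) (m : nat) (l : X -> X -> K)
    (l_sym : forall x y, l x y = l y x) (l_inv : Lambda l \in unitmx)
    (G P : series K X) (G_B : in_B G) (P_Bplus : in_Bplus P)
    (G_gauss : eq_B G (series_mul P (series_exp (quadratic l)))) :
  eq_closed m (int_neg m G)
    (((-1) ^+ (m * #|X|) * (\det (Lambda l)) ^+ m) *: int_FG l P).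
Proof.
have char0 n : n.+1%:R != 0 :> K by rewrite (pcharf0P K).1.
pose S := @closed_relator K m.
have rel0 u : S u -> proj S u = 0.
  by move=> Su; rewrite -(linear0 (proj S)); apply/proj_eq; rewrite subr0; apply: span_gen.
move=> n _; apply/proj_eq.
apply: etrans (int_neg_int_FG char0 rel0 l_sym l_inv n G_B P_Bplus G_gauss) _.
by rewrite -linearZ.
Qed.
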